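(* Let $L$ be an intrinsic location functional and $0<T\le1$. Let $I_{L,T}$ be the set of laws $F^{\mathbf X}_{L,T}$ as $\mathbf X$ ranges over all periodic stationary processes with period $1$. Then $I_{L,T}$ is a convex subset of $\mathcal P_T$, and $I_{L,T}\subseteq C(E_T)$.
   Context: Let $H$ be a set of functions $\mathbb R\to\mathbb R$ with period $1$, invariant under shifts ($g\in H$, $c\in\mathbb R$ imply $\theta_cg\in H$, where $\theta_cg(x)=g(x+c)$), equipped with the cylindrical $\sigma$-field. Let $\mathcal I$ be the set of compact intervals $[a,b]$ with $a<b$. An intrinsic location functional is a map $L:H\times\mathcal I\to\mathbb R\cup\{\infty\}$ such that: (i) $L(\cdot,I)$ is measurable for each $I$; (ii) $L(g,I)\in I\cup\{\infty\}$; (iii) $L(g,I)=L(\theta_cg,I-c)+c$ (with $\infty+c=\infty$); (iv) if $I_2\subseteq I_1$ and $L(g,I_1)\in I_2$ then $L(g,I_2)=L(g,I_1)$; (v) if $I_2\subseteq I_1$ and $L(g,I_2)\ne\infty$ then $L(g,I_1)\ne\infty$. A periodic stationary process with period $1$ is a stationary process $\mathbf X=\{X(t)\}_{t\in\mathbb R}$ with continuous sample paths of period $1$ lying in $H$. $F^{\mathbf X}_{L,T}$ is the law of $L(\mathbf X,[0,T])$ on $[0,T]\cup\{\infty\}$; its restriction to $(0,T)$ is absolutely continuous with a càdlàg density. $\mathcal P_T$ is the set of probability distributions on $[0,T]\cup\{\infty\}$ that are absolutely continuous on $(0,T)$. A function $f$ on $(0,T)$ satisfies condition (TV) if $\mathrm{TV}_{(t_1,t_2)}(f)\le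 f(t_1)+f(t_2)$ for all $0<t_1<t_2<T$, where $\mathrm{TV}_{(t_1,t_2)}(f)=\sup\sum_{i=1}^{n-1}|f(s_{i+1})-f(s_i)|$ over $t_1<s_1<\dots<s_n<t_2$. $E_T$ is the set of $F\in\mathcal P_T$ whose càdlàg density $f$ on $(0,T)$ satisfies: (1) $f$ takes non-negative integer values; (2) $f$ satisfies (TV); (3) if $F([0,T])>0$ and there is no $t\in(0,T)$ with $F([0,t])=1$ or $F([t,T])=1$, then $f\ge1$ on $(0,T)$, and if moreover $F(\{\infty\})>0$ then $f-1$ satisfies (TV). For $A\subseteq\mathcal P_T$, $C(A)$ denotes the closed convex hull of $A$ in the weak topology. *)

(* Defs.v *)
From HB Require Import structures.
From mathcomp Require Import all_boot all_order all_algebra.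
From mathcomp Require Import all_classical all_reals all_analysis.
From mathcomp Require Import measurable_realfun.
Set Implicit Arguments. Unset Strict Implicit. Unset Printing Implicit Defensive.
Import Order.TTheory GRing.Theory Num.Theory.
Import numFieldNormedType.Exports.
Local Open Scope classical_set_scope.
Local Open Scope ring_scope.

Section Defs.
Variable R : realType.

Definition shift (c : R) (g : R -> R) : R -> R := fun x => g (x + c).

Definition cyl_sets : set (set (R -> R)) :=
  <<s [set (fun g : R -> R => g t) @^-1` B | t in [set: R] & B in @measurable _ R] >>.

Definition admissible_H (H : set (R -> R)) : Prop :=
  (forall g, H g -> forall x, g (x + 1) = g x) /\
  (forall g c, H g -> H (shift c g)).

(* An intrinsic location functional L : H x I -> R \cup {oo}.  The compact
   interval [a,b] (a < b) is encoded by its endpoints; oo is +oo in \bar R.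
   Only the values on H x I are constrained. *)
Definition intrinsic_location (H : set (R -> R)) (L : (R -> R) -> R -> R -> \bar R)
  : Prop :=
  (* (i) measurability w.r.t. the (trace on H of the) cylindrical sigma-field *)
  (forall a b, a < b -> forall B : set (\bar R), measurable B ->
     exists A, cyl_sets A /\
       H `&` [set g | B (L g a b)] = H `&` A) /\
  (forall g a b, H g -> a < b ->
     L g a b = +oo%E \/ (a%:E <= L g a b <= b%:E)%E) /\
  (forall g a b c, H g -> a < b ->
     L g a b = (L (shift c g) (a - c)%R (b - c)%R + c%:E)%E) /\
  (forall g a1 b1 a2 b2, H g -> a1 <= a2 -> a2 < b2 -> b2 <= b1 ->
     (a2%:E <= L g a1 b1 <= b2%:E)%E -> L g a2 b2 = L g a1 b1) /\
  (forall g a1 b1 a2 b2, H g -> a1 <= a2 -> a2 < b2 -> b2 <= b1 ->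
     L g a2 b2 != +oo%E -> L g a1 b1 != +oo%E).

Definition periodic_stationary (H : set (R -> R)) d (Omega : measurableType d)
  (P : probability Omega R) (X : Omega -> R -> R) : Prop :=
  (forall t, measurable_fun [set: Omega] (fun w => X w t)) /\
  (forall w, continuous (X w)) /\
  (forall w t, X w (t + 1) = X w t) /\
  (forall w, H (X w)) /\
  (forall c A, cyl_sets A ->
     P (X @^-1` A) = P ((fun w => shift c (X w)) @^-1` A)).

Definition KT (T : R) : set (\bar R) := (EFin @` `[0%R, T]) `|` [set +oo%E].

Definition is_law_of (H : set (R -> R)) (L : (R -> R) -> R -> R -> \bar R)
  (T : R) (F : probability (\bar R) R) : Prop :=
  exists d (Omega : measurableType d) (P : probability Omega R) (X : Omega -> R -> R),
    periodic_stationary H P X /\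
    forall B : set (\bar R), measurable B ->
      F B = P [set w | B (L (X w) 0 T)].

Definition I_LT H L T : set (probability (\bar R) R) := is_law_of H L T.

Definition P_T (T : R) : set (probability (\bar R) R) :=
  [set F | F (~` KT T) = 0%E /\
     forall A : set R, measurable A -> A `<=` `]0%R, T[ ->
       (@lebesgue_measure R) A = 0%E -> F (EFin @` A) = 0%E].

Definition TV (f : R -> R) (t1 t2 : R) : \bar R :=
  ereal_sup [set v : \bar R | exists (n : nat) (s : nat -> R),
     (forall i, (i <= n)%N -> t1 < s i < t2) /\
     (forall i, (i < n)%N -> s i < s i.+1) /\
     v = (\sum_(0 <= i < n) `|f (s i.+1) - f (s i)|)%:E].

Definition TV_cond (T : R) (f : R -> R) : Prop :=
  forall t1 t2, 0 < t1 -> t1 < t2 -> t2 < T -> (TV f t1 t2 <= (f t1 + f t2)%:E)%E.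

Definition cadlag_on (T : R) (f : R -> R) : Prop :=
  forall t, 0 < t < T -> f x @[x --> t^'+] --> f t /\ cvg (f x @[x --> t^'-]).

Definition density_on (T : R) (F : probability (\bar R) R) (f : R -> R) : Prop :=
  forall A : set R, measurable A -> A `<=` `]0%R, T[ ->
    F (EFin @` A) = (\int[@lebesgue_measure R]_(x in A) (f x)%:E)%E.

Definition E_T (T : R) : set (probability (\bar R) R) :=
  [set F | P_T T F /\ exists f : R -> R,
     cadlag_on T f /\ density_on T F f /\
     (* (1) *) (forall t, 0 < t < T -> exists n : nat, f t = n%:R) /\
     (* (2) *) TV_cond T f /\
     ((0 < F (EFin @` `[0%R, T]))%E ->
      ~ (exists t, 0 < t < T /\
           (F (EFin @` `[0%R, t]) = 1%E \/ F (EFin @` `[t, T]) = 1%E)) ->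
      (forall t, 0 < t < T -> 1 <= f t) /\
      ((0 < F [set +oo%E])%E -> TV_cond T (fun t => f t - 1)))].

Definition conv_hull (A : set (probability (\bar R) R)) : set (probability (\bar R) R) :=
  [set G | exists n (Fs : 'I_n -> probability (\bar R) R) (w : 'I_n -> R),
     (forall i, A (Fs i)) /\ (forall i, 0 <= w i) /\ \sum_(i < n) w i = 1 /\
     forall B, measurable B -> G B = (\sum_(i < n) (w i)%:E * Fs i B)%E].

(* bounded continuous test functions on K_T = [0,T] \cup {oo}
   (oo is an isolated point of K_T) *)
Definition test_fun (T : R) (phi : \bar R -> R) : Prop :=
  {within `[0%R, T], continuous (fun x => phi x%:E)}.

(* closed convex hull C(A), closure taken in the weak topology on the
   probability laws on K_T *)
Definition C_hull (T : R) (A : set (probability (\bar R) R)) :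
    set (probability (\bar R) R) :=
  [set F | F (~` KT T) = 0%E /\
     forall k (phi : 'I_k -> \bar R -> R) (eps : R),
       (forall j, test_fun T (phi j)) -> 0 < eps ->
       exists G, conv_hull A G /\ G (~` KT T) = 0%E /\
         forall j, (`| \int[F]_(x in KT T) (phi j x)%:E
                     - \int[G]_(x in KT T) (phi j x)%:E | < eps%:E)%E].

Definition convex_laws (S : set (probability (\bar R) R)) : Prop :=
  forall F G (lam : R), S F -> S G -> 0 <= lam <= 1 ->
    exists M, S M /\ forall B, measurable B ->
      M B = (lam%:E * F B + (1 - lam)%:E * G B)%E.

End Defs.

(* Main.v *)
Require Import Defs.
From mathcomp Require Import all_boot all_order all_algebra.
From mathcomp Require Import all_classical all_reals all_analysis.
From mathcomp Require Import measurable_realfun.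
From mathcomp Require Import finmap.
From mathcomp Require Import lra zify.
Import Order.TTheory GRing.Theory Num.Theory.
Import numFieldNormedType.Exports.
Local Open Scope classical_set_scope.
Local Open Scope ring_scope.

(** Slide the window of length T along a fixed path and record the position of
    the location relative to the window.  While the selected point stays the
    same this position moves at unit speed; it can only leave such a line when
    the point exits through the end T, or when a point entering at 0 takes over,
    and symmetrically for the beginning of a line.  Hence the density at level t
    of the law for a uniformly shifted path is the number of lines crossing t in
    one period.  Two lines that both start above t1 are separated by an upward
    crossing of t2, and so are two visits at infinity; counting the lines meeting
    ]t1, t2[ in this way gives (TV), and (TV) for f - 1 when infinity is visited.
    So the law of every uniformly shifted path is in E_T.  By stationarity the law
    of the process is the average of these laws over its paths, and for finitely
    many test functions an average is approximated by finite convex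
    combinations. *)

(** * Lines of a path and level crossings *)

(** Nothing is assumed of a path [s] beyond the clauses of [loc_path], not even one-sided
    continuity. The instants where a line begins or visibility ends are therefore suprema that need
    not be attained, and all that is known there is that visits above [t2] occur in every []w, p]].
    The arithmetic of (TV) is a double count modulo 1. The levels met by one line form an interval,
    so the line causes at most one rise and one fall of [f] along a chain of levels; hence
    [f t1 + V + f t2 <= 2 |D|], with [V] the variation along the chain and [D] the lines met. The
    lines of [D] that miss [t1] interlace with the crossings of [t2], so [|D| <= f t1 + f t2], and
    (TV) follows. An invisible time adds one point to the interlaced family and so gains [2],
    exactly what replacing [f] by [f - 1] costs on the right. The law of a path need not depend
    continuously on the path; only measurability is at hand, so the average is discretised by
    cutting the probability space along finitely many bounded measurable functions. *)

Lemma approx_sup {R : realType} (N : set R) (a b : R) :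
  N a -> (forall x, N x -> x <= b) ->
  exists z, [/\ a <= z, z <= b, forall x, N x -> x <= z &
    forall e, 0 < e -> exists2 x, N x & z - e < x].
Proof.
move=> Na Nb; have hN : has_sup N by split; [exists a|exists b].
exists (sup N); split.
- exact: sup_upper_bound.
- by apply: ge_sup => //; exists a.
- exact: sup_upper_bound.
- by move=> e e0; apply: sup_adherent.
Qed.

(* s v codes the position of the location relative to the window [-v, T - v];
   a value outside [0, T] codes an infinite location.  The last three clauses are
   what (iii), (iv) and (v) say about two windows. *)
Record loc_path {R : realType} (T : R) (s : R -> R) : Prop := LocPath {
  lp_per : forall v, s (v + 1) = s v ;
  lp_mono : forall v w, v < w -> 0 <= s v <= T -> 0 <= s w <= T ->
    s w <= s v + (w - v) ;
  lp_fwd : forall v w, v < w -> w - v < T -> 0 <= s v <= T ->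
    s v + (w - v) <= T ->
    0 <= s w <= T /\ (s w = s v + (w - v) \/ s w < w - v) ;
  lp_bwd : forall v w, v < w -> w - v < T -> 0 <= s w <= T ->
    w - v <= s w ->
    0 <= s v <= T /\ (s v = s w - (w - v) \/ T - (w - v) < s v) }.

(* c stands for the line v |-> v - c, which reaches level t at time c + t.  Looking
   only after that time makes the number of lines right-continuous in t. *)
Definition crossing {R : realType} (s : R -> R) (t : R) : set R :=
  [set c | exists2 d, 0 < d & forall e, 0 < e < d -> s (c + t + e) = t + e].

Section Path.
Context {R : realType} (T : R) (s : R -> R).
Hypothesis sP : loc_path T s.
Implicit Types v w r t c e d : R.

Let C := crossing s.

(** The bound [w - v < T - t2] keeps the old point inside the window, and a point that entered at 0
    meanwhile would lie below [w - v < t1]. *)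
Lemma same_line v w t1 t2 : v < w -> w - v < t1 -> w - v < T - t2 ->
  t1 <= s v <= t2 -> t1 <= s w -> s w = s v + (w - v).
Proof.
move=> vw d1 d2 sv sw.
have [|||_ [//|]] := lp_fwd _ _ sP _ _ vw; lra.
Qed.

(** By [lp_mono] the label (time minus value) never decreases over visible times. A point taking
    over by time [r] would have a label above [v], while the label at [w] is below [v]. *)
Lemma on_line_between v r w : v < r -> r < w -> 0 < s v -> s w <= T ->
  s w = s v + (w - v) -> s r = s v + (r - v).
Proof.
move=> vr rw sv swT sw.
have [|||vis_r [//|]] := lp_fwd _ _ sP _ _ vr; try lra.
move=> sr; have := lp_mono _ _ sP _ _ rw vis_r; lra.
Qed.

(** Closer lines would be identified by [same_line]. The factor 1/2 leaves room for the offset [e]: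
    a crossing prescribes [s] only strictly after the level is reached. *)
Lemma crossing_spaced t c c' : 0 < t -> t < T -> C t c -> C t c' ->
  c < c' -> Num.min t (T - t) / 2 <= c' - c.
Proof.
move=> t0 tT [d d0 dP] [d' d0' dP'] cc'.
set m := Num.min t (T - t); have [mt mT] : m <= t /\ m <= T - t.
  by rewrite /m; split; rewrite ge_min lexx ?orbT.
have m0 : 0 < m by rewrite lt_min t0; lra.
rewrite leNgt; apply/negP => H.
pose e := Num.min (m / 4) (Num.min d d' / 2).
have [e1 e2 e3 e4] : [/\ 0 < e, e <= m / 4, e <= d / 2 & e <= d' / 2].
  rewrite /e !lt_min !ge_min; split; rewrite ?lexx //.
  - by rewrite divr_gt0 // divr_gt0 // lt_min d0.
  - by rewrite [X in _ || X]ler_pM2r ?invr_gt0// ge_min lexx !orbT.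
  - by rewrite [X in _ || X]ler_pM2r ?invr_gt0// ge_min lexx !orbT.
have h1 : s (c + t + e) = t + e by apply: dP; lra.
have h2 : s (c' + t + e) = t + e by apply: dP'; lra.
have := @same_line (c + t + e) (c' + t + e) t (t + e).
rewrite h1 h2 => /(_ ltac:(lra) ltac:(lra) ltac:(lra) ltac:(lra) ltac:(lra)).
lra.
Qed.

Lemma crossing_per t c : C t c -> C t (c + 1).
Proof.
move=> [d d0 dP]; exists d => // e /dP <-.
by rewrite -[RHS](lp_per _ _ sP); congr s; lra.
Qed.

Lemma crossing_perN t c : C t c -> C t (c - 1).
Proof.
move=> [d d0 dP]; exists d => // e /dP <-.
by rewrite -[LHS](lp_per _ _ sP); congr s; lra.
Qed.

Lemma crossing_itv t1 t t2 c : 0 < t1 -> t1 < t -> t < t2 -> t2 < T ->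
  C t1 c -> C t2 c -> C t c.
Proof.
move=> t10 t1t tt2 t2T [d1 d10 dP1] [d2 d20 dP2].
exists (t2 - t) => [|e e0]; first lra.
pose e1 := Num.min (d1 / 2) (t - t1).
pose e2 := Num.min (d2 / 2) (T - t2).
have [? ?] : e1 <= d1 / 2 /\ e1 <= t - t1.
  by rewrite /e1; split; rewrite ge_min lexx ?orbT.
have [? ?] : e2 <= d2 / 2 /\ e2 <= T - t2.
  by rewrite /e2; split; rewrite ge_min lexx ?orbT.
have ? : 0 < e1 by rewrite lt_min; apply/andP; split; lra.
have ? : 0 < e2 by rewrite lt_min; apply/andP; split; lra.
have h1 := dP1 e1 ltac:(lra); have h2 := dP2 e2 ltac:(lra).
have := @on_line_between (c + t1 + e1) (c + t + e) (c + t2 + e2).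
rewrite h1 h2; move=> H; rewrite H; lra.
Qed.

(** Let [z] be the supremum of the times in [[w, v]] with value outside []t, T]]. Near [z] neither
    end of the window interferes, so visits on both sides of [z] share one line, and that line has
    to be at level [t] at time [z]. *)
Lemma crossing_of_upcross t w v : 0 < t -> t < T -> w < v ->
  ~~ (t < s w <= T) -> t < s v <= T ->
  exists2 c, C t c & w <= c + t < v.
Proof.
move=> t0 tT wv Hw Hv.
pose N := [set r | w <= r <= v /\ ~~ (t < s r <= T)].
have Nw : N w by split; [lra|].
have [z [wz zv zU zA]] := @approx_sup _ N w v Nw (fun x h => ltac:(case: h; lra)).
have Hi r : z < r -> r <= v -> t < s r <= T.
  move=> zr rv; apply: contrapT => /negP H; have : N r by split; [lra|].
  by move/zU; lra.
pose m := Num.min t (T - t).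
have [mt mT] : m <= t /\ m <= T - t.
  by rewrite /m; split; rewrite ge_min lexx ?orbT.
have m0 : 0 < m by rewrite lt_min t0; lra.
have Nr r : N r -> r != v by move=> [_]; apply: contraNneq => ->; lra.
(* Going back from [v] by less than [e], both alternatives of [lp_bwd] leave the value in []t, T]],
   so the exceptional times stay away from [v]. *)
have zv' : z < v.
  rewrite lt_neqAle zv andbT; apply/eqP => zE.
  pose e := Num.min m (s v - t).
  have [? ?] : e <= m /\ e <= s v - t.
    by rewrite /e; split; rewrite ge_min lexx ?orbT.
  have e0 : 0 < e by rewrite lt_min m0; lra.
  have [r Nr1 rz] := zA e e0.
  have rv : r < v by rewrite lt_neqAle (Nr _ Nr1) -zE zU.
  have [|||vr] := lp_bwd _ _ sP r v rv; try lra.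
  by case: Nr1 => _ /negP nH [h|h]; apply: nH; lra.
pose h := Num.min (v - z) (m / 2).
have [h1 h2] : h <= v - z /\ h <= m / 2.
  by rewrite /h; split; rewrite ge_min lexx ?orbT.
have h0 : 0 < h by rewrite lt_min; apply/andP; split; lra.
(* [lp_bwd] makes [r] visible, hence [s r <= t]. The exit at [T] is then too far away, and
   [s r' > t] is too high for a point entered since [r]. *)
have lin r r' : N r -> z - m / 2 < r -> z < r' -> r' < z + h ->
    s r <= t /\ s r' = s r + (r' - r).
  move=> Nr1 zr zr' r'h; have rz := zU _ Nr1.
  have Hr' := Hi r' zr' ltac:(lra).
  have [||||vr _] := lp_bwd _ _ sP r r'; try lra.
  have srt : s r <= t.
    rewrite leNgt; apply/negP => sr; case: Nr1 => _ /negP; apply; lra.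
  have [||||_ [//|]] := lp_fwd _ _ sP r r'; lra.
have [r0 Nr0 zr0] := zA (m / 2) ltac:(lra).
have L0 r' : z < r' -> r' < z + h -> s r' = s r0 + (r' - r0).
  by move=> a b; case: (lin r0 r' Nr0 zr0 a b).
(* A line above [t] at [z] would also be above [t] at late members of [N]; a line below [t] at [z]
   would still be below just after [z]. *)
have zt : z + s r0 - r0 = t.
  apply/eqP; rewrite eq_le; apply/andP; split.
  - rewrite leNgt; apply/negP => H.
    pose e := Num.min (m / 2) (z + s r0 - r0 - t).
    have [? ?] : e <= m / 2 /\ e <= z + s r0 - r0 - t.
      by rewrite /e; split; rewrite ge_min lexx ?orbT.
    have e0 : 0 < e by rewrite lt_min; apply/andP; split; lra.
    have [r1 Nr1 zr1] := zA e e0.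
    have [? E1] := lin r1 (z + h / 2) Nr1 ltac:(lra) ltac:(lra) ltac:(lra).
    have := L0 (z + h / 2) ltac:(lra) ltac:(lra).
    have := zU _ Nr1; lra.
  - rewrite leNgt; apply/negP => H.
    pose e := Num.min (h / 2) (t - (z + s r0 - r0)).
    have [? ?] : e <= h / 2 /\ e <= t - (z + s r0 - r0).
      by rewrite /e; split; rewrite ge_min lexx ?orbT.
    have e0 : 0 < e by rewrite lt_min; apply/andP; split; lra.
    have := L0 (z + e) ltac:(lra) ltac:(lra).
    have := Hi (z + e) ltac:(lra) ltac:(lra); lra.
exists (z - t); last lra.
exists h => // e e0.
have -> : z - t + t + e = z + e by lra.
rewrite L0; lra.
Qed.

Lemma line_start t1 t2 u c : 0 < t1 -> t1 < u -> u <= t2 -> t2 < T ->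
  C u c -> ~ C t1 c ->
  exists p, [/\ c + t1 < p, p <= c + u,
    exists2 d, 0 < d & forall r, p < r -> r < c + u + d -> s r = r - c &
    forall w, w < p -> exists2 v, w < v <= p & t2 < s v <= T].
Proof.
move=> t10 t1u ut2 t2T [d d0 dP] nC.
pose N := [set r | c + t1 < r <= c + u /\ s r != r - c].
have [a Na] : exists a, N a.
  apply: contrapT => nE; apply: nC; exists (u - t1) => [|e e0]; first lra.
  apply: contrapT => /eqP H; apply: nE; exists (c + t1 + e); split; first lra.
  by apply: contra_neq H => ->; lra.
have [p [ap pu pU pA]] := @approx_sup _ N a (c + u) Na (fun x h => ltac:(case: h; lra)).
have lin r : p < r -> r <= c + u -> s r = r - c.
  move=> pr ru; apply: contrapT => /eqP H.
  have : N r by case: (Na) => ? _; split; [lra|].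
  by move/pU; lra.
have lin' r : p < r -> r < c + u + d -> s r = r - c.
  move=> pr ru; case: (leP r (c + u)) => [|ur]; first exact: lin.
  have := dP (r - c - u) ltac:(lra).
  have -> : c + u + (r - c - u) = r by lra.
  lra.
have cp : c + t1 < p by case: Na; lra.
exists p; split=> //; first by exists d.
move=> w wp.
pose m := Num.min t1 (T - t2) / 2.
have [mt mT m0] : [/\ m <= t1 / 2, m <= (T - t2) / 2 & 0 < m].
  rewrite /m !ler_pM2r ?invr_gt0//; split; rewrite ?ge_min ?lexx ?orbT //.
  by rewrite divr_gt0 // lt_min t10; lra.
pose e := Num.min m (Num.min (p - w) d).
have [e1 e2 e3] : [/\ e <= m, e <= p - w & e <= d].
  by rewrite /e; split; rewrite !ge_min lexx ?orbT.
have e0 : 0 < e by rewrite !lt_min m0 d0; lra.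
have [r Nr rp] := pA e e0; have rp' := pU _ Nr.
exists r; first lra.
have sr' := lin' (p + e / 2) ltac:(lra) ltac:(lra).
have [||||vr] := lp_bwd _ _ sP r (p + e / 2); try lra.
by case: Nr => _ /eqP Nr []; lra.
Qed.

(** The location can be lost only through the end [T]: after a visit at level at most [t], [lp_fwd]
    ensures visibility for a short time. Hence visible times close to their supremum [p] have values
    above [t]. *)
Lemma before_invisible t w v : t < T -> 0 <= s w <= T -> ~~ (0 <= s v <= T) ->
  w < v -> exists p, [/\ w <= p, p <= v &
    forall w, w < p -> exists2 v, w < v <= p & t < s v <= T].
Proof.
move=> tT vw nv wv.
have T0 : 0 < T \/ T = 0 by move: vw; lra.
pose N := [set r | w <= r <= v /\ 0 <= s r <= T].
have Nw : N w by split; [lra|].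
have [p [wp pv pU pA]] := @approx_sup _ N w v Nw (fun x h => ltac:(case: h; lra)).
exists p; split=> // w' wp'.
case: T0 => [T0|T0].
  pose m := Num.min T (T - t) / 2.
  have [mt mT m0] : [/\ m <= T / 2, m <= (T - t) / 2 & 0 < m].
    rewrite /m !ler_pM2r ?invr_gt0//; split; rewrite ?ge_min ?lexx ?orbT //.
    by rewrite divr_gt0 // lt_min T0; lra.
  pose e := Num.min m (p - w').
  have [e1 e2] : e <= m /\ e <= p - w'.
    by rewrite /e; split; rewrite !ge_min lexx ?orbT.
  have e0 : 0 < e by rewrite !lt_min m0; lra.
  have [r Nr rp] := pA e e0; have rp' := pU _ Nr.
  exists r; first lra.
  (* An invisible time at or just after [p]; the cap by [v] covers the case [p = v]. *)
  pose q := Num.min v (p + e / 2).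
  have [q1 q2] : q <= v /\ q <= p + e / 2.
    by rewrite /q; split; rewrite !ge_min lexx ?orbT.
  have qp : p <= q by rewrite le_min pv; lra.
  have nq : ~~ (0 <= s q <= T).
    have [qE|qv] := eqVneq q v; first by rewrite qE.
    have pq : p < q.
      have pv' : p < v by rewrite lt_neqAle pv andbT; apply: contra_neq qv => pE; rewrite /q pE; apply/min_idPl; lra.
      by rewrite lt_min pv'; lra.
    apply/negP => vq; have /pU : N q by split; [lra|].
    lra.
  have rq : r < q.
    rewrite lt_neqAle; apply/andP; split; last lra.
    by apply: contraNneq nq => <-; case: Nr.
  case: (Nr) => _ vr; rewrite ltNge; apply/andP; split; last lra.
  apply/negP => srt; move/negP: nq; apply.
  by have [||||] := lp_fwd _ _ sP r q; lra.
have [r Nr rp] := pA (p - w') ltac:(lra).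
by exists r; [have := pU _ Nr; lra|case: Nr; lra].
Qed.

(** If [u = t2], the line [c] itself serves. Otherwise the value is at most [t2] just after time
    [c + u] and above [t2] by time [p]; the upward crossing in between has a label at least [c] by
    [lp_mono]. *)
Lemma crossing_after_line t1 t2 u c p q : 0 < t1 -> t1 <= u -> u <= t2 ->
  t2 < T -> C u c -> c + u < p -> p <= q + t2 ->
  (forall w, w < p -> exists2 v, w < v <= p & t2 < s v <= T) ->
  exists2 b, C t2 b & c <= b < q.
Proof.
move=> t10 t1u ut2 t2T Cc cp pq high.
have [uE|uN] := eqVneq u t2; first by exists c; [rewrite -uE|lra].
have ut : u < t2 by rewrite lt_neqAle uN.
case: Cc => d d0 dP.
pose e := Num.min (d / 2) (Num.min (t2 - u) ((p - c - u) / 2)).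
have [e1 e2 e3] : [/\ e <= d / 2, e <= t2 - u & e <= (p - c - u) / 2].
  by rewrite /e; split; rewrite !ge_min lexx ?orbT.
have e0 : 0 < e by rewrite !lt_min; apply/and3P; split; lra.
have sw := dP e ltac:(lra).
have [v wv Hv] := high (c + u + e) ltac:(lra).
have nH : ~~ (t2 < s (c + u + e) <= T) by apply/negP; lra.
have [||||b Cb bv] := @crossing_of_upcross t2 (c + u + e) v _ _ _ nH; try lra.
exists b => //; apply/andP; split; last lra.
case: Cb => d' d0' dP'.
pose e' := Num.min (d' / 2) (T - t2).
have [e1' e2'] : e' <= d' / 2 /\ e' <= T - t2.
  by rewrite /e'; split; rewrite !ge_min lexx ?orbT.
have e0' : 0 < e' by rewrite !lt_min; apply/andP; split; lra.
have sw' := dP' e' ltac:(lra).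
have := lp_mono _ _ sP (c + u + e) (b + t2 + e').
rewrite sw sw' => H; have := H ltac:(lra) ltac:(lra) ltac:(lra); lra.
Qed.

Lemma crossing_after_invisible t v p q : 0 < t -> t < T ->
  ~~ (0 <= s v <= T) -> v < p -> p <= q + t ->
  (forall w, w < p -> exists2 v, w < v <= p & t < s v <= T) ->
  exists2 b, C t b & v - t <= b < q.
Proof.
move=> t0 tT nv vp pq high; have [v' vv' Hv'] := high v vp.
have nH : ~~ (t < s v <= T) by apply: contra nv; lra.
have [||||c Cc cv] := @crossing_of_upcross t v v' _ _ _ nH; try lra.
by exists c => //; lra.
Qed.

End Path.

(** * Counting modulo one *)

Section Counting.
Context {R : realType}.
Implicit Types (A B Q : set R) (x y m : R).

Definition spaced m A := forall x y, A x -> A y -> x < y -> m <= y - x.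

Definition periodic1 A := forall x, A x -> A (x + 1) /\ A (x - 1).

Definition count01 A : nat := #|` fset_set (A `&` `[0, 1[%classic)|%fset.

Lemma periodic1_int A (k : int) x : periodic1 A -> A x -> A (x + k%:~R).
Proof.
move=> pA; elim: k x => [x|n IH x|n IH x] Ax; first by rewrite addr0.
- by rewrite intS rmorphD/= addrA; apply: IH; case: (pA _ Ax).
- rewrite intS opprD rmorphD/= addrA rmorphN/=.
  by apply: IH; case: (pA _ Ax).
Qed.

Lemma injective_finite_set {T1 T2 : choiceType} (f : T1 -> T2) (E : set T1)
    (F : set T2) : (forall a b, E a -> E b -> f a = f b -> a = b) ->
  (forall a, E a -> F (f a)) -> finite_set F ->
  finite_set E /\ (#|` fset_set E | <= #|` fset_set F |)%N.
Proof.
move=> finj fEF fF.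
have finj' : {in E &, injective f} by move=> a b /set_mem Ea /set_mem Eb; apply: finj.
have fE : finite_set E.
  apply: (@card_le_finite _ _ _ (f @` E)).
    by have := inj_card_eq finj'; rewrite card_eq_le => /andP[].
  by apply: sub_finite_set fF => _ [a Ea <-]; exact: fEF.
split=> //.
rewrite -(@card_in_imfset imfset_key _ _ f (mem (fset_set E))) /=; last first.
  by move=> a b; rewrite !in_fset_set// => aE bE; exact: finj'.
apply: fsubset_leq_card; apply/fsubsetP => _ /imfsetP[a /= aE ->].
by rewrite in_fset_set//; apply/mem_set/fEF/set_mem; rewrite -(in_fset_set fE).
Qed.

Lemma count01_le A B : A `<=` B -> finite_set (B `&` `[0, 1[) ->
  (count01 A <= count01 B)%N.
Proof.
move=> AB fB; apply: (proj2 (@injective_finite_set _ _ idfun _ _ _ _ fB)) => //.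
by move=> x [/AB Bx Ix]; split.
Qed.

Lemma count01U A B : finite_set (A `&` `[0, 1[) -> finite_set (B `&` `[0, 1[) ->
  count01 (A `|` B) = (count01 A + count01 (B `\` A))%N.
Proof.
move=> fA fB; rewrite /count01.
have fBA : finite_set ((B `\` A) `&` `[0, 1[).
  by apply: sub_finite_set fB => x [[Bx _] ix]; split.
have -> : (A `|` B) `&` `[0, 1[ = (A `&` `[0, 1[) `|` ((B `\` A) `&` `[0, 1[).
  apply/seteqP; split=> x.
  - by move=> [[Ax|Bx] ix]; [left|case: (pselect (A x)) => Ax; [left|right]].
  - by move=> [[Ax ix]|[[Bx _] ix]]; split=> //; [left|right].
rewrite fset_setU// cardfsU (_ : (_ `&` _)%fset = fset0) ?cardfs0 ?subn0//.
apply/fsetP => x; rewrite in_fsetI !in_fset_set// in_fset0.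
by apply/negP => /andP[/set_mem[Ax _] /set_mem[[_]]].
Qed.

Lemma count01_gt0 A x : finite_set (A `&` `[0, 1[) -> periodic1 A -> A x ->
  (0 < count01 A)%N.
Proof.
move=> fA pA Ax; rewrite cardfs_gt0; apply/fset0Pn.
exists (x - (Num.floor x)%:~R); rewrite in_fset_set//; apply/mem_set.
split; first by rewrite -rmorphN/=; exact: periodic1_int.
by rewrite /= in_itv/=; have := floor_itv x; rewrite rmorphD/=; lra.
Qed.

Lemma spaced_finite m A : 0 < m -> spaced m A -> finite_set (A `&` `[0, 1[).
Proof.
move=> m0 sA; pose f x := Num.truncn (x / m).
have m10 : 0 <= m^-1 by rewrite invr_ge0 ltW.
apply: (proj1 (@injective_finite_set _ _ f _ `I_(Num.truncn m^-1).+1 _ _ (finite_II _))).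
  move=> x y [Ax +] [Ay]; rewrite /= !in_itv/= => x01 y01 fxy.
  have /andP[x1 x2] : (f x)%:R <= x / m < (f x).+1%:R.
    by apply: truncn_itv; rewrite divr_ge0//; lra.
  have /andP[y1 y2] : (f y)%:R <= y / m < (f y).+1%:R.
    by apply: truncn_itv; rewrite divr_ge0//; lra.
  move: x1 x2 y1 y2; rewrite fxy -natr1.
  rewrite !ler_pdivlMr// !ltr_pdivrMr// mulrDl mul1r => x1 x2 y1 y2.
  by case: (ltgtP x y) => // xy; [have := sA _ _ Ax Ay xy|have := sA _ _ Ay Ax xy]; lra.
move=> x [Ax]; rewrite /= in_itv/= => x01; rewrite ltnS; apply: le_truncn.
by rewrite ler_piMl//; lra.
Qed.

Lemma finite_uniform_radius {I : choiceType} (A : set I) (P : I -> R -> Prop) :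
  finite_set A ->
  (forall a h h', P a h -> 0 < h' -> h' <= h -> P a h') ->
  (forall a, A a -> exists2 h, 0 < h & P a h) ->
  exists2 h, 0 < h & forall a, A a -> P a h.
Proof.
move=> /finite_seqP[u ->] mP; elim: u => [|a u IH] h; first by exists 1.
have [a' au|h1 h10 Ph1] := IH; first by apply: h; rewrite /= inE au orbT.
have [|h2 h20 Ph2] := h a; first by rewrite /= inE eqxx.
exists (Num.min h1 h2) => [|b]; first by rewrite lt_min h10.
rewrite /= inE => /orP[/eqP ->|bu].
- by apply: (mP _ _ _ Ph2); rewrite ?lt_min ?h10// ge_min lexx orbT.
- by apply: (mP _ _ _ (Ph1 _ bu)); rewrite ?lt_min ?h10// ge_min lexx.
Qed.

(* Each q in Q is sent to the last point of B before it; two points of Q are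
   separated by a point of B, so this is injective modulo 1. *)
Lemma count01_interlaced m Q B : 0 < m -> spaced m B -> periodic1 B ->
  periodic1 Q -> (forall q q', Q q -> Q q' -> q < q' ->
    exists2 b, B b & q <= b < q') ->
  finite_set (Q `&` `[0, 1[) /\ (count01 Q <= count01 B)%N.
Proof.
move=> m0 sB pB pQ QB.
(* The point [q - 1] of [Q] provides a point of [B] before [q]; the supremum of such points is
   attained because [B] is spaced. *)
have last q : exists b, Q q -> [/\ B b, b < q & forall c, B c -> c < q -> c <= b].
  case: (pselect (Q q)) => [Qq|]; last by exists 0.
  have [b0 Bb0 b0q] := QB _ _ (proj2 (pQ _ Qq)) Qq ltac:(lra).
  have [z [_ _ zU zA]] := @approx_sup _ [set b | B b /\ b < q] b0 q
    (conj Bb0 (proj2 (andP b0q))) (fun x h => ltW (proj2 h)).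
  have [b [Bb bq] zb] := zA m m0.
  exists b => _; split=> // c Bc cq; rewrite leNgt; apply/negP => bc.
  by have := sB _ _ Bb Bc bc; have := zU c (conj Bc cq); lra.
have [f fP] := choice last.
apply: (@injective_finite_set _ _ (fun q => f q - (Num.floor (f q))%:~R)).
- move=> x y [Qx +] [Qy]; rewrite /= !in_itv/= => x01 y01 fxy.
  pose k : int := Num.floor (f y) - Num.floor (f x).
  have fk : f y = f x + k%:~R by rewrite rmorphB/=; lra.
  have [Bx fx mx] := fP _ Qx; have [By fy my] := fP _ Qy.
  (* [f y = f x + k] is the last point of [B] before [x + k] as well as before [y]; a point of [B]
     separating these two would be later. *)
  have xky : x + k%:~R = y.
    case: (ltgtP (x + k%:~R) y) => // H.
    - have [b Bb /andP[b1 b2]] := QB _ _ (periodic1_int Q k x pQ Qx) Qy H.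
      by have := my _ Bb b2; lra.
    - have [b Bb /andP[b1 b2]] := QB _ _ Qy (periodic1_int Q k x pQ Qx) H.
      have := mx (b - k%:~R); rewrite -rmorphN/= => /(_ (periodic1_int _ _ _ pB Bb)).
      by rewrite rmorphN/=; lra.
  have : k%:~R < (1 : R) by lra.
  have : (-1 : R) < k%:~R by lra.
  rewrite -[1 in X in X -> _]/(1%:~R) -[1 in X in _ -> X -> _]/(1%:~R).
  rewrite -rmorphN/= !ltr_int => k1 k2; move: xky.
  have -> : k = 0 by lia.
  by rewrite addr0.
- move=> x [Qx _]; have [Bx _ _] := fP _ Qx; split.
    by rewrite -rmorphN/=; exact: periodic1_int.
  by rewrite /= in_itv/=; have := floor_itv (f x); rewrite rmorphD/=; lra.
- exact: (spaced_finite _ _ m0 sB).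
Qed.

End Counting.

(** * Local structure near a level *)

Section Local.
Context {R : realType} (T : R) (s : R -> R).
Hypothesis sP : loc_path T s.
Implicit Types v w r t c e d : R.

Let C := crossing s.

Lemma crossing_periodic t : periodic1 (C t).
Proof. by move=> c Cc; split; [exact: crossing_per sP _ _ Cc|exact: crossing_perN sP _ _ Cc]. Qed.

Lemma loc_path_int (k : int) v : s (v + k%:~R) = s v.
Proof.
suff : periodic1 [set x | s x = s v] by move=> /(periodic1_int _ k v); apply.
move=> x /= <-; split; first exact: lp_per sP _.
by rewrite -[LHS](lp_per _ _ sP); congr s; lra.
Qed.

Lemma finite_crossing t : 0 < t < T -> finite_set (C t `&` `[0, 1[).
Proof.
move=> /andP[t0 tT]; apply: (spaced_finite (Num.min t (T - t) / 2)).
  by rewrite divr_gt0// lt_min t0 subr_gt0.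
by move=> c c'; exact: crossing_spaced sP t c c' t0 tT.
Qed.

(** If the labels differ by less than [m], the visits are less than [2 * m] apart: one [m] for the
    labels, one for the levels. The third [m] in the hypotheses is the height of the band, since
    [same_line] is applied with upper level [t + m]. *)
Lemma lines_between t m : 0 < m -> 3 * m <= t -> 3 * m <= T - t ->
  finite_set ([set c | exists2 v, v - s v = c & t < s v < t + m] `&` `[0, 1[).
Proof.
move=> m0 mt mT; apply: (spaced_finite _ _ m0) => c c'.
move=> [v vc sv] [v' vc' sv'] cc'.
have vv' : v < v'.
  case: (ltgtP v v') => // [H|H]; last by move: vc vc'; rewrite H; lra.
  have := lp_mono _ _ sP _ _ H; lra.
rewrite leNgt; apply/negP => H.
have := same_line T s sP v v' t (t + m) vv'; lra.
Qed.

(** Modulo 1 only finitely many lines visit a band above [t]. A line with visits arbitrarily close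
    above [t] crosses [t] by [on_line_between]; any other avoids []t, t + h[] for small [h].
    Finiteness makes the radius uniform. *)
Lemma right_structure t : 0 < t < T -> exists2 h, 0 < h &
  [/\ t + h <= T, forall v, t < s v < t + h -> C t (v - s v) &
     forall c, C t c -> forall u, t < u < t + h -> s (c + u) = u].
Proof.
move=> tT; pose m := Num.min t (T - t) / 3.
have [m1 m2 m0] : [/\ 3 * m <= t, 3 * m <= T - t & 0 < m].
  have [? ?] : Num.min t (T - t) <= t /\ Num.min t (T - t) <= T - t.
    by split; rewrite ge_min lexx ?orbT.
  rewrite /m; split; [lra|lra|rewrite divr_gt0// lt_min; lra].
have fin := lines_between t m m0 m1 m2.
pose P c h := (forall v, v - s v = c -> t < s v < t + h -> C t c) /\
  (C t c -> forall u, t < u < t + h -> s (c + u) = u).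
have [|c _|h0 h00 hP] := finite_uniform_radius _ P fin.
- by move=> c h h' [P1 P2] h'0 h'h; split=> [v vc sv|Cc u tu];
    [apply: (P1 v) => //|apply: P2 => //]; lra.
- have [Cc|nC] := pselect (C t c).
    case: (Cc) => d d0 dP; exists d => //; split=> // _ u tu.
    have := dP (u - t) ltac:(lra).
    by have -> : c + t + (u - t) = c + u by [lra]; lra.
  apply: contrapT => nP; apply: nC.
  have near_line h : 0 < h -> exists2 v, v - s v = c & t < s v < t + h.
    move=> h0; apply: contrapT => H; apply: nP; exists h => //; split.
      by move=> v vc sv; exfalso; apply: H; exists v.
    move=> [d d0 dP]; exfalso; apply: H.
    pose e := Num.min d h / 2.
    have [e0 ed eh] : [/\ 0 < e, e < d & e < h].
      have : Num.min d h <= d by rewrite ge_min lexx.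
      have : Num.min d h <= h by rewrite ge_min lexx orbT.
      have : 0 < Num.min d h by rewrite lt_min d0; lra.
      by rewrite /e; split; lra.
    have sv := dP e ltac:(lra).
    by exists (c + t + e); rewrite sv; lra.
  have [v vc sv] := near_line (T - t) ltac:(lra).
  exists (s v - t); first lra.
  move=> e e0; have [w wc sw] := near_line e ltac:(lra).
  have := on_line_between T s sP w (c + t + e) v; lra.
pose h := Num.min h0 m.
have [hh0 hm] : h <= h0 /\ h <= m by split; rewrite ge_min lexx ?orbT.
have h_gt0 : 0 < h by rewrite lt_min h00.
(* The radius was found for labels in [[0, 1[]; translation by integers carries it to all labels. *)
have hP' k c : 0 <= c + k%:~R < 1 ->
   (exists2 v, v - s v = c & t < s v < t + m) -> P (c + k%:~R) h0.
  move=> ck [v vc sv]; apply: hP; split; last by rewrite /= in_itv.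
  by exists (v + k%:~R); rewrite loc_path_int; lra.
have hP2 c : (exists2 v, v - s v = c & t < s v < t + m) ->
    exists k : int, P (c + k%:~R) h0.
  move=> H; exists (- Num.floor c); apply: hP' => //.
  by rewrite rmorphN/=; have := floor_itv c; rewrite rmorphD/=; lra.
exists h => //; split; first lra.
- move=> v sv; have [|k [Pk _]] := hP2 (v - s v); first by exists v => //; lra.
  have := Pk (v + k%:~R); rewrite loc_path_int => /(_ ltac:(lra) ltac:(lra)).
  move=> /(periodic1_int _ (- k) _ (crossing_periodic t)).
  by rewrite rmorphN/= addrK.
- move=> c Cc u tu; have [|k [_ Pk]] := hP2 c.
    case: (Cc) => d d0 dP; pose e := Num.min d m / 2.
    have [e0 ed eh] : [/\ 0 < e, e < d & e < m].
      have : Num.min d m <= d by rewrite ge_min lexx.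
      have : Num.min d m <= m by rewrite ge_min lexx orbT.
      have : 0 < Num.min d m by rewrite lt_min d0; lra.
      by rewrite /e; split; lra.
    have sv := dP e ltac:(lra).
    by exists (c + t + e); rewrite sv; lra.
  have := Pk (periodic1_int _ k _ (crossing_periodic t) Cc) u ltac:(lra).
  by have -> : c + k%:~R + u = c + u + k%:~R by [lra]; rewrite loc_path_int.
Qed.

Lemma crossing_right t h : 
  (forall v, t < s v < t + h -> C t (v - s v)) ->
  (forall c, C t c -> forall u, t < u < t + h -> s (c + u) = u) ->
  forall u, t < u < t + h -> C u = C t.
Proof.
move=> vC Cv u tu; apply/seteqP; split=> c Cc.
- case: Cc => d d0 dP; pose e := Num.min d (t + h - u) / 2.
  have [e0 ed eh] : [/\ 0 < e, e < d & e < t + h - u].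
    have : Num.min d (t + h - u) <= d by rewrite ge_min lexx.
    have : Num.min d (t + h - u) <= t + h - u by rewrite ge_min lexx orbT.
    have : 0 < Num.min d (t + h - u) by rewrite lt_min d0; lra.
    by rewrite /e; split; lra.
  have sv := dP e ltac:(lra).
  have := vC (c + u + e); rewrite sv => H.
  have := H ltac:(lra); congr C; lra.
- exists (t + h - u); first lra.
  move=> e e0; have := Cv c Cc (u + e) ltac:(lra).
  by have -> : c + (u + e) = c + u + e by lra.
Qed.

End Local.

(** Reversing time and reflecting the window exchanges [lp_fwd] and [lp_bwd]; values outside
    [[0, T]] stay outside, so the coding of infinity is kept. *)
Lemma loc_path_rev {R : realType} (T : R) (s : R -> R) : loc_path T s ->
  loc_path T (fun v => T - s (- v)).
Proof.
move=> sP; split.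
- move=> v; congr (_ - _); rewrite -[LHS](lp_per _ _ sP); congr s; lra.
- move=> v w vw sv sw; have := lp_mono _ _ sP (- w) (- v); lra.
- move=> v w vw wT sv svw; have [|||| ? ?] := lp_bwd _ _ sP (- w) (- v); lra.
- move=> v w vw wT sv svw; have [|||| ? ?] := lp_fwd _ _ sP (- w) (- v); lra.
Qed.

(** This is [right_structure] for the reversed path at level [T - t]. Level [t] itself is excluded:
    a line coming from below may end there. *)
Lemma crossing_left {R : realType} (T : R) (s : R -> R) t : loc_path T s ->
  0 < t < T -> exists2 h, 0 < h & forall u u', t - h < u < t -> t - h < u' < t ->
  crossing s u `<=` crossing s u'.
Proof.
move=> sP tT.
have [|h h0 [hT vC Cv]] := right_structure T _ (loc_path_rev _ _ sP) (T - t).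
  lra.
exists h => // u u' tu tu' c [d d0 dP].
pose e := Num.min d (t - u) / 2.
have [e0 ed eh] : [/\ 0 < e, e < d & e < t - u].
  have : Num.min d (t - u) <= d by rewrite ge_min lexx.
  have : Num.min d (t - u) <= t - u by rewrite ge_min lexx orbT.
  have : 0 < Num.min d (t - u) by rewrite lt_min d0; lra.
  by rewrite /e; split; lra.
have sv := dP e ltac:(lra).
have := vC (- (c + u + e)); rewrite opprK sv => H.
have {}H := Cv _ (H ltac:(lra)).
exists (t - u'); first lra.
move=> e' e'0; have := H (T - u' - e') ltac:(lra).
have -> : - (- (c + u + e) - (T - (u + e)) + (T - u' - e')) = c + u' + e' by lra.
lra.
Qed.

(** * The total variation condition *)

Section Variation.
Context {R : realType} (T : R) (s : R -> R).
Hypothesis sP : loc_path T s.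
Implicit Types v w r t c e d : R.

Let C := crossing s.

Lemma crossing_visit t c h : t < T -> 0 < h -> C t c ->
  exists e, [/\ 0 < e, e < h, t + e <= T & s (c + t + e) = t + e].
Proof.
move=> tT h0 [d d0 dP]; pose e := Num.min d (Num.min h (T - t)) / 2.
have [e0 ed eh eT] : [/\ 0 < e, e < d, e < h & e < T - t].
  have : Num.min d (Num.min h (T - t)) <= d by rewrite ge_min lexx.
  have : Num.min d (Num.min h (T - t)) <= h by rewrite !ge_min lexx !orbT.
  have : Num.min d (Num.min h (T - t)) <= T - t by rewrite !ge_min lexx !orbT.
  have : 0 < Num.min d (Num.min h (T - t)) by rewrite !lt_min d0 h0; lra.
  by rewrite /e; split; lra.
by exists e; split; [| |lra|apply: dP; lra].
Qed.

Definition lines t1 t2 : set R := [set c | exists2 u : R, t1 <= u <= t2 & C u c].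

(** Before the location is lost there is a visit above [t2], by [before_invisible], hence a crossing
    of [t2] at or after the line [c]. The case [v = c + u] cannot occur: the visits just after it
    make [v] visible. *)
Lemma crossing_line_invisible t1 t2 u c v : 0 < t1 -> t1 < t2 -> t2 < T ->
  t1 <= u <= t2 -> C u c -> ~~ (0 <= s v <= T) ->
  c + u <= v -> exists2 b, C t2 b & c <= b < v - t2.
Proof.
move=> t10 t12 t2T u12 Cc nv cv.
have [vE|vN] := eqVneq v (c + u).
  have [e [e0 e2 eT se]] := crossing_visit u c t2 ltac:(lra) ltac:(lra) Cc.
  have [||||vv _] := lp_bwd _ _ sP v (c + u + e); lra.
have [|e [e0 e2 eT se]] := crossing_visit u c (v - (c + u)) ltac:(lra) _ Cc.
  by move: vN; rewrite neq_lt => /orP[]; lra.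
have vw : 0 <= s (c + u + e) <= T by lra.
have [p [wp pv high]] := before_invisible T s sP t2 (c + u + e) v t2T vw nv ltac:(lra).
by apply: (crossing_after_line T s sP t1 t2 u c p) => //; lra.
Qed.

(** Keeps the code [v - t2] of an invisible time apart from every line, so that both can be counted
    in one set. *)
Lemma line_ne_invisible t1 t2 c v : 0 < t1 -> t1 < t2 -> t2 < T ->
  lines t1 t2 c -> ~~ (0 <= s v <= T) ->
  c != v - t2.
Proof.
move=> t10 t12 t2T [u u12 Cc] nv; apply/eqP => cE.
have [|b _] := crossing_line_invisible t1 t2 u c v t10 t12 t2T u12 Cc nv; lra.
Qed.

(** An invisible time [v] is coded by [v - t2], the label of a line that would be at level [t2] at
    time [v]. The later element [q'] is preceded by a visit above [t2] ([line_start] for a line,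
    [before_invisible] for an invisible time), while [q] either crosses [t2] or supplies a time with
    value not above [t2]; an upward crossing lies in between. *)
Lemma lines_interlaced t1 t2 (X : set R) : 0 < t1 -> t1 < t2 -> t2 < T ->
  (forall v, X v -> ~~ (0 <= s v <= T)) ->
  (forall v v', X v -> X v' -> v < v' -> exists2 w, v < w < v' & 0 <= s w <= T) ->
  forall q q', ((lines t1 t2 `\` C t1) `|` [set v - t2 | v in X]) q ->
    ((lines t1 t2 `\` C t1) `|` [set v - t2 | v in X]) q' -> q < q' ->
  exists2 b, C t2 b & q <= b < q'.
Proof.
move=> t10 t12 t2T Xi Xs q q' [Dq|[v Xv <-]] [Dq'|[v' Xv' <-]] qq'; last first.
- have [w vw visw] := Xs v v' Xv Xv' ltac:(lra).
  have [|p [wp pv high]] := before_invisible T s sP t2 w v' t2T visw (Xi _ Xv') _.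
    lra.
  by apply: (crossing_after_invisible T s sP t2 v p (v' - t2) _ _ (Xi _ Xv)) => //; lra.
- case: Dq' => Dq' nC1; case: (Dq') => u' u'12 Cq'.
  have t1u' : t1 < u'.
    rewrite lt_neqAle; apply/andP; split; last lra.
    by apply/eqP => uE; apply: nC1; rewrite uE.
  have [p [p1 p2 [d d0 lin] high]] :=
    line_start T s sP t1 t2 u' q' t10 t1u' ltac:(lra) t2T Cq' nC1.
  (* From [p] on, the line [q'] is followed until past level [u']; losing it later but by time [v]
     would require a crossing in [[q', v - t2[], which is empty. *)
  suff vp : v < p.
    by apply: (crossing_after_invisible T s sP t2 v p q' _ _ (Xi _ Xv)) => //; lra.
  rewrite ltNge le_eqVlt; apply/negP => /orP[/eqP pv|pv].
    pose e := Num.min d (Num.min t1 (T - t2)) / 2.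
    have [e0 ed et eT] : [/\ 0 < e, e < d, e < t1 & e < T - t2].
      have : Num.min d (Num.min t1 (T - t2)) <= d by rewrite ge_min lexx.
      have : Num.min d (Num.min t1 (T - t2)) <= t1 by rewrite !ge_min lexx !orbT.
      have : Num.min d (Num.min t1 (T - t2)) <= T - t2 by rewrite !ge_min lexx !orbT.
      have : 0 < Num.min d (Num.min t1 (T - t2)) by rewrite !lt_min d0 t10; lra.
      by rewrite /e; split; lra.
    have se := lin (p + e) ltac:(lra) ltac:(lra).
    have [||||vv _] := lp_bwd _ _ sP p (p + e); try lra.
    by move: (Xi _ Xv); rewrite -pv vv.
  case: (ltP v (q' + u' + d)) => vd.
    have sv := lin v pv vd.
    have := Xi _ Xv; rewrite sv => /negP; apply; lra.
  have [b _ ?] := crossing_line_invisible t1 t2 u' q' v t10 t12 t2T u'12 Cq' (Xi _ Xv) ltac:(lra).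
  lra.
- case: Dq => -[u u12 Cq] _.
  by apply: (crossing_line_invisible t1 t2 u q v' t10 t12 t2T u12 Cq (Xi _ Xv')); lra.
- case: Dq' => Dq' nC1; case: (Dq') => u' u'12 Cq'.
  have t1u' : t1 < u'.
    rewrite lt_neqAle; apply/andP; split; last lra.
    by apply/eqP => uE; apply: nC1; rewrite uE.
  have [p [p1 p2 [d d0 lin] high]] :=
    line_start T s sP t1 t2 u' q' t10 t1u' ltac:(lra) t2T Cq' nC1.
  case: Dq => [[u u12 Cq] _].
  (* Otherwise [q'] would be visited before [q], and the label would decrease, against [lp_mono]. *)
  suff up : q + u < p.
    by apply: (crossing_after_line T s sP t1 t2 u q p) => //; lra.
  rewrite ltNge; apply/negP => pu.
  have [e [e0 ed eT se]] := crossing_visit u q d ltac:(lra) d0 Cq.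
  pose e' := Num.min e (T - t2) / 2.
  have [e'0 e'e e'T] : [/\ 0 < e', e' < e & e' < T - t2].
    have : Num.min e (T - t2) <= e by rewrite ge_min lexx.
    have : Num.min e (T - t2) <= T - t2 by rewrite !ge_min lexx !orbT.
    have : 0 < Num.min e (T - t2) by rewrite !lt_min e0; lra.
    by rewrite /e'; split; lra.
  have se' := lin (p + e') ltac:(lra) ltac:(lra).
  have := lp_mono _ _ sP (p + e') (q + u + e); lra.
Qed.

Definition crossing_number t : R := (count01 (C t))%:R.

Let f := crossing_number.

Definition chain_lines t1 (n : nat) (x : nat -> R) : set R :=
  [set c | C t1 c \/ exists2 i, (i <= n)%N & C (x i) c].

Lemma finite_chain_lines t1 t2 n x : 0 < t1 -> t2 < T ->
  (forall i, (i <= n)%N -> t1 < x i < t2) ->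
  finite_set (chain_lines t1 n x `&` `[0, 1[).
Proof.
move=> t10 t2T; elim: n => [|n IH] xi.
  have f1 := finite_crossing T s sP t1.
  have f2 := finite_crossing T s sP (x 0%N).
  have x0 := xi 0%N isT.
  have H : finite_set ((C t1 `&` `[0, 1[) `|` (C (x 0%N) `&` `[0, 1[)).
    by rewrite finite_setU; split; [apply: f1|apply: f2]; lra.
  apply: sub_finite_set H => c [[Cc|[i i0 Ci]] cI]; first by left.
  by move: i0 Ci; rewrite leqn0 => /eqP -> Ci; right.
have f2 := finite_crossing T s sP (x n.+1).
have x0 := xi n.+1 (leqnn _).
have H : finite_set ((chain_lines t1 n x `&` `[0, 1[) `|` (C (x n.+1) `&` `[0, 1[)).
  rewrite finite_setU; split; last by apply: f2; lra.
  exact: (IH (fun i h => xi i (leqW h))).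
apply: sub_finite_set H => c [[Cc|[i + Ci]] cI]; first by left; split => //; left.
rewrite leq_eqVlt => /orP[/eqP iE|ni]; first by rewrite iE in Ci; right.
by left; split=> //; right; exists i.
Qed.

Lemma chain_variation t1 t2 n x : 0 < t1 -> t2 < T ->
  (forall i, (i <= n)%N -> t1 < x i < t2) ->
  (forall i, (i < n)%N -> x i < x i.+1) ->
  f t1 + \sum_(0 <= i < n) `|f (x i.+1) - f (x i)| + f (x n) <=
  2 * (count01 (chain_lines t1 n x))%:R.
Proof.
move=> t10 t2T; elim: n => [|n IH] xi xS.
  rewrite big_geq// addr0.
  have le c : 0 < c < T -> C c `<=` chain_lines t1 0 x ->
      f c <= (count01 (chain_lines t1 0 x))%:R.
    move=> c0 H; rewrite ler_nat; apply: count01_le => //.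
    exact: (finite_chain_lines t1 t2).
  have x0 := xi 0%N isT.
  have := le t1 ltac:(lra) (fun c h => or_introl h).
  have := le (x 0%N) ltac:(lra) (fun c h => or_intror (ex_intro2 _ _ 0%N isT h)).
  lra.
have {}IH := IH (fun i h => xi i (leqW h)) (fun i h => xS i (leqW h)).
rewrite big_nat_recr//=.
have xn := xi n.+1 (leqnn _); have xn' := xi n (leqnSn _); have xnn := xS n (leqnn _).
have fin t : 0 < t < T -> finite_set (C t `&` `[0, 1[) by exact: finite_crossing sP t.
have -> : chain_lines t1 n.+1 x = chain_lines t1 n x `|` C (x n.+1).
  apply/seteqP; split=> c.
  - case=> [Cc|[i]]; first by left; left.
    rewrite leq_eqVlt => /orP[/eqP ->|ni Cc]; first by right.
    by left; right; exists i.
  - case=> [[Cc|[i ni Cc]]|Cc]; first by left.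
      by right; exists i => //; exact: leqW.
    by right; exists n.+1.
have incr i j : (i < j)%N -> (j <= n.+1)%N -> x i < x j.
  elim: j => // j IHj; rewrite ltnS leq_eqVlt => /orP[/eqP ->|ij] jn.
    exact: xS.
  by apply: lt_trans (IHj ij (ltnW jn)) (xS _ jn).
(* By [crossing_itv], a line met at an earlier level and again at [x n.+1] also crosses [x n]; so
   only the last level decides which lines are new. *)
have E : C (x n.+1) `\` chain_lines t1 n x = C (x n.+1) `\` C (x n).
  apply/seteqP; split=> c [Cc nC]; split=> //.
    by move=> Cn; apply: nC; right; exists n.
  case=> [C1|[i]]; first by apply: nC; apply: (crossing_itv T s sP t1 _ (x n.+1)) => //; lra.
  rewrite leq_eqVlt => /orP[/eqP ->//|ni Ci].
  have ii := xi i (ltnW (leqW ni)).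
  by apply: nC; apply: (crossing_itv T s sP (x i) _ (x n.+1)) => //; [lra|exact: incr|lra].
rewrite count01U; [|exact: (finite_chain_lines t1 t2 n x t10 t2T (fun i h => xi i (leqW h)))|by apply: fin; lra].
rewrite E natrD mulrDr.
have : f (x n.+1) <= f (x n) + (count01 (C (x n.+1) `\` C (x n)))%:R.
  rewrite -natrD -count01U; [|by apply: fin; lra|by apply: fin; lra].
  rewrite ler_nat; apply: count01_le; first by move=> c; right.
  by rewrite setIUl finite_setU; split; apply: fin; lra.
have : 0 <= (count01 (C (x n.+1) `\` C (x n)))%:R :> R by [].
(* With the end value added, a fall leaves the left side unchanged, and a rise increases it by twice
   its height, at most twice the number of new lines. *)
by case: (ger0P (f (x n.+1) - f (x n))); lra.
Qed.

(* The extra term k is 1 as soon as some v is invisible; this is what makes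
   f - 1 satisfy (TV) when the location is infinite with positive probability. *)
Lemma crossing_variation t1 t2 n x (k : nat) : 0 < t1 -> t2 < T ->
  (forall i, (i <= n)%N -> t1 < x i < t2) ->
  (forall i, (i < n)%N -> x i < x i.+1) ->
  k = 0%N \/ k = 1%N /\ (exists v, ~~ (0 <= s v <= T)) /\ (exists v, 0 <= s v <= T) ->
  \sum_(0 <= i < n) `|f (x i.+1) - f (x i)| + 2 * k%:R <= f t1 + f t2.
Proof.
move=> t10 t2T xi xS kP; have x0 := xi 0%N isT; have xn := xi n (leqnn _).
have V := chain_variation t1 t2 n x t10 t2T xi xS.
have fin t : 0 < t < T -> finite_set (C t `&` `[0, 1[) by exact: finite_crossing sP t.
pose D := chain_lines t1 n x `|` C t2.
have finD : finite_set (D `&` `[0, 1[).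
  rewrite setIUl finite_setU; split; first exact: (finite_chain_lines t1 t2).
  by apply: fin; lra.
have V2 : f t1 + \sum_(0 <= i < n) `|f (x i.+1) - f (x i)| + f t2 <=
    2 * (count01 D)%:R.
  rewrite /D count01U; [|exact: (finite_chain_lines t1 t2)|by apply: fin; lra].
  rewrite natrD mulrDr.
  have : f t2 <= f (x n) + (count01 (C t2 `\` chain_lines t1 n x))%:R.
    rewrite -natrD.
    have -> : C t2 `\` chain_lines t1 n x = C t2 `\` C (x n).
      apply/seteqP; split=> c [Cc nC]; split=> //.
        by move=> Cn; apply: nC; right; exists n.
      have incr i j : (i < j)%N -> (j <= n)%N -> x i < x j.
        elim: j => // j IHj; rewrite ltnS leq_eqVlt => /orP[/eqP ->|ij] jn.
          exact: xS.
        by apply: lt_trans (IHj ij (ltnW jn)) (xS _ jn).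
      case=> [C1|[i]]; first by apply: nC; apply: (crossing_itv T s sP t1 _ t2) => //; lra.
      rewrite leq_eqVlt => /orP[/eqP ->//|ni Ci].
      have ii := xi i (ltnW ni).
      by apply: nC; apply: (crossing_itv T s sP (x i) _ t2) => //; [lra|exact: incr|lra].
    rewrite -count01U; [|by apply: fin; lra|by apply: fin; lra].
    rewrite ler_nat; apply: count01_le; first by move=> c; right.
    by rewrite setIUl finite_setU; split; apply: fin; lra.
  have : 0 <= (count01 (C t2 `\` chain_lines t1 n x))%:R :> R by [].
  lra.
have C1D : C t1 `<=` D by move=> c Cc; left; left.
have DE : count01 D = (count01 (C t1) + count01 (D `\` C t1))%N.
  rewrite -count01U//; last by apply: fin; lra.
  by congr count01; apply/seteqP; split=> c; [right|case=> // /C1D].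
have Dl : D `<=` lines t1 t2.
  move=> c [[Cc|[i ni Cc]]|Cc]; [exists t1 => //|exists (x i) => //|exists t2 => //]; try lra.
  by have := xi i ni; lra.
have perD : periodic1 D.
  move=> c; have pC t := crossing_periodic T s sP t.
  case=> [[Cc|[i ni Cc]]|Cc]; have [? ?] := pC _ _ Cc; split; by
    [left; left|left; right; exists i|right].
(* Then [2 |D| <= 2 f t1 + 2 f t2 - 2 k], and [V2] already has one [f t1] and one [f t2] on its left
   side. *)
suff : (count01 (D `\` C t1) + k <= count01 (C t2))%N.
  rewrite -(ler_nat R) natrD => K.
  move: V2; rewrite DE natrD /f /crossing_number; lra.
pose m := Num.min t2 (T - t2) / 2.
have m0 : 0 < m by rewrite divr_gt0// lt_min; lra.
have sC : spaced m (C t2) by move=> c c' *; apply: (crossing_spaced T s sP) => //; lra.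
have pC2 := crossing_periodic T s sP t2.
have pD1 : periodic1 (D `\` C t1).
  move=> c [Dc nC]; have [? ?] := perD _ Dc; split; split=> // H; apply: nC.
    by have [_] := crossing_periodic T s sP t1 _ H; rewrite addrK.
  by have [+ _] := crossing_periodic T s sP t1 _ H; rewrite subrK.
case: kP => [->|[-> [[v nv] [w vw]]]].
  rewrite addn0; apply: (proj2 (count01_interlaced m _ _ m0 sC pC2 pD1 _)).
  move=> q q' [Dq nq] [Dq' nq'].
  apply: (lines_interlaced t1 t2 set0 t10 _ t2T) => //; try lra.
  - by left; split=> //; exact: Dl.
  - by left; split=> //; exact: Dl.
(* All translates of one invisible time, separated by translates of the visible time [w]; modulo 1
   they contribute the single extra point [k = 1]. *)
pose X := [set v + j%:~R | j in [set: int]].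
have Xi r : X r -> ~~ (0 <= s r <= T) by move=> [j _ <-]; rewrite (loc_path_int T s sP).
pose Y := [set r - t2 | r in X].
have pY : periodic1 Y.
  move=> _ [_ [j _ <-] <-]; split.
  - exists (v + (j + 1)%:~R); first by exists (j + 1).
    by rewrite rmorphD/=; lra.
  - exists (v + (j - 1)%:~R); first by exists (j - 1).
    by rewrite rmorphB/=; lra.
have pQ : periodic1 ((D `\` C t1) `|` Y).
  by move=> c [/pD1|/pY] [? ?]; split; by [left|right].
have [|finQ] := count01_interlaced m _ _ m0 sC pC2 pQ.
  move=> q q' Qq Qq'; apply: (lines_interlaced t1 t2 X t10 _ t2T) => //; try lra.
  - move=> _ _ [i _ <-] [j _ <-] ij.
    have {}ij : i < j by move: ij; rewrite ltrD2l ltr_int.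
    pose l := Num.floor (v + i%:~R - w).
    have /andP[l1 l2] := floor_itv (v + i%:~R - w).
    exists (w + (l + 1)%:~R); last by rewrite (loc_path_int T s sP).
    have ij1 : i%:~R + 1 <= j%:~R :> R by move: ij; rewrite -lezD1 -(ler_int R) intrD.
    apply/andP; split; first by rewrite /l; lra.
    have : w + (l + 1)%:~R <= v + j%:~R by rewrite rmorphD/= /l; lra.
    rewrite le_eqVlt => /orP[/eqP wE|//].
    by have := Xi _ (ex_intro2 _ _ j I erefl); rewrite -wE (loc_path_int T s sP) vw.
  - by case: Qq => [[Dq nq]|Yq]; [left; split=> //; exact: Dl|right].
  - by case: Qq' => [[Dq nq]|Yq]; [left; split=> //; exact: Dl|right].
apply: leq_trans; move: finQ; rewrite setIUl finite_setU => -[fin1 fin2].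
rewrite count01U// leq_add2l.
have -> : Y `\` (D `\` C t1) = Y.
  apply/seteqP; split=> c; first by case.
  move=> Yc; split=> // -[/Dl Dc _]; case: Yc => r /Xi nr cE.
  have := line_ne_invisible t1 t2 c r t10 ltac:(lra) t2T Dc nr.
  by rewrite cE eqxx.
by apply: (count01_gt0 Y (v - t2)) => //; exists v => //; exists 0; rewrite ?addr0.
Qed.

Lemma crossing_number_ge1 t w v : 0 < t < T -> ~~ (t < s w <= T) ->
  t < s v <= T -> 1 <= f t.
Proof.
move=> tT nw hv.
(* The [- 1] makes the translate of [w] strictly earlier than [v] even when [v - w] is an
   integer. *)
pose j := Num.floor (v - w) - 1.
have jv : w + j%:~R < v.
  by rewrite /j rmorphB/=; have := floor_itv (v - w); rewrite rmorphD/=; lra.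
rewrite -(loc_path_int T s sP j) in nw.
have [||c Cc _] := crossing_of_upcross T s sP t _ _ _ _ jv nw hv; try lra.
rewrite /f /crossing_number ler1n.
by apply: (count01_gt0 _ c) => //; [exact: (finite_crossing T s)|exact: (crossing_periodic T s)].
Qed.

Lemma crossing_number_ge1_invisible t w v : 0 < t < T ->
  ~~ (0 <= s w <= T) -> 0 <= s v <= T -> 1 <= f t.
Proof.
move=> tT nw hv.
pose j := Num.floor (w - v) - 1.
have jv : v + j%:~R < w.
  by rewrite /j rmorphB/=; have := floor_itv (w - v); rewrite rmorphD/=; lra.
have visv : 0 <= s (v + j%:~R) <= T by rewrite (loc_path_int T s sP).
have [|p [_ _ high]] := before_invisible T s sP t _ _ _ visv nw jv; first lra.
have [u _ hu] := high (p - 1) ltac:(lra).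
apply: (crossing_number_ge1 t w u) => //.
by apply: contra nw; lra.
Qed.

End Variation.

(** * The law of a path has the crossing number as density *)

Section Occupation.
Context {R : realType}.
Notation leb := (@lebesgue_measure R).
Implicit Types (A B : set R).

Let shiftr (a : R) : measurableTypeR R -> measurableTypeR R := fun v => v + a.

Let measurable_shiftr a : measurable_fun setT (shiftr a).
Proof. exact: measurable_funD. Qed.

Lemma measurable_preimage_shift (a : R) A : measurable A ->
  measurable [set v : R | A (v + a)].
Proof. by move=> mA; have := measurable_shiftr a measurableT A mA; rewrite setTI. Qed.

Lemma lebesgue_measure_shift (a : R) A : measurable A ->
  leb [set v | A (v + a)] = leb A.
Proof.
move=> mA; have mf := measurable_shiftr a.
pose mu : {measure set (measurableTypeR R) -> \bar R} := pushforward leb (shiftr a).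
rewrite (@lebesgue_measure_unique R (mu mf) _ A mA)// => X /ocitvP[->|[[x y] /= xy ->]].
  by rewrite !measure0.
rewrite /mu /= /pushforward.
have -> : shiftr a @^-1` `]x, y] = `]x - a, y - a]%classic.
  by apply/seteqP; split=> v; rewrite /shiftr /= !in_itv/= ltrBlDr lerBrDr.
rewrite !lebesgue_measure_itv /= !lte_fin xy ltrD2r xy -!EFinB; congr EFin.
lra.
Qed.

(* An occurrence at time v in [0,1[ of a value u in B lies on the line v - u,
   which is in [0,1[ up to a translation by 1. *)
Lemma lebesgue_occupation (s : R -> R) (C : set R) B :
  measurable B -> B `<=` `]0, 1[ -> periodic1 C -> finite_set (C `&` `[0, 1[) ->
  (forall c u, C c -> B u -> s (c + u) = u) ->
  (forall v, B (s v) -> C (v - s v)) ->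
  leb (`[0, 1[ `&` s @^-1` B) = ((count01 C)%:R%:E * leb B)%E.
Proof.
move=> mB B01 pC fC Cs sC.
have B0 u : B u -> 0 < u < 1 by move=> /B01; rewrite /= in_itv.
(* As [B] lies in []0, 1[], the line [c] takes its values in [B] at times in []c, c + 1[]: [Y1] is
   the part before time 1, [Y2] the rest, brought back by one period. *)
pose Y1 (c : R) : set R := `[0, 1[%classic `&` [set v : R | B (v - c)].
pose Y2 (c : R) : set R := `[0, 1[%classic `&` [set v : R | B (v + (1 - c))].
have mY1 c : measurable (Y1 c).
  by apply: measurableI => //; exact: measurable_preimage_shift.
have mY2 c : measurable (Y2 c).
  by apply: measurableI => //; exact: measurable_preimage_shift.
have mY (c : R) : 0 <= c < 1 -> leb (Y1 c `|` Y2 c) = leb B.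
  move=> c01.
  have disj (v : R) : ~ (Y1 c `&` Y2 c) v.
    by move=> [[_ /= /B0 ?] [_ /= /B0 ?]]; lra.
  transitivity (leb (Y1 c) + leb (Y2 c))%E.
    by apply: measureU; [exact: mY1|exact: mY2|apply/seteqP; split => // v /disj].
  have -> : Y1 c = [set v : R | (B `&` `[- c, 1 - c[) (v + (- c))].
    by apply/seteqP; split=> v; rewrite /Y1 /Y2 /= !in_itv/= => -[? ?]; split=> //; lra.
  have -> : Y2 c = [set v : R | (B `&` `[1 - c, 2 - c[) (v + (1 - c))].
    by apply/seteqP; split=> v; rewrite /Y1 /Y2 /= !in_itv/= => -[? ?]; split=> //; lra.
  rewrite !lebesgue_measure_shift; [|exact: measurableI|exact: measurableI].
  transitivity (leb ((B `&` `[- c, 1 - c[) `|` (B `&` `[1 - c, 2 - c[))).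
    apply/esym; apply: measureU; [exact: measurableI|exact: measurableI|].
    have dis (u : R) : ~ ((B `&` `[- c, 1 - c[) `&` (B `&` `[1 - c, 2 - c[)) u.
      by move=> [[_ +] [_ +]]; rewrite /= !in_itv/=; lra.
    by apply/seteqP; split => // u /dis.
  congr (leb _); rewrite -setIUr; apply/seteqP; split=> [u []//|u Bu]; split=> //.
  have := B0 _ Bu => u01.
  case: (ltP u (1 - c)) => ?; [left|right]; rewrite /= in_itv/=; lra.
have E : `[0, 1[ `&` s @^-1` B = \bigcup_(c in C `&` `[0, 1[) (Y1 c `|` Y2 c).
  apply/seteqP; split=> v.
  - move=> [v01 /= Bs]; have Cc := sC v Bs; have s01 := B0 _ Bs.
    have v01' : 0 <= v < 1 by move: v01; rewrite /= in_itv.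
    case: (leP 0 (v - s v)) => H.
    + exists (v - s v); first by split => //=; rewrite in_itv/=; lra.
      by left; split=> //=; have -> : v - (v - s v) = s v by lra.
    + exists (v - s v + 1); first by split => /=; [case: (pC _ Cc)|rewrite in_itv/=; lra].
      by right; split=> //=; have -> : v + (1 - (v - s v + 1)) = s v by lra.
  - move=> [c [Cc c01] [[v01 /= Bv]|[v01 /= Bv]]]; split => //=.
      by rewrite -(subrK c v) addrC (Cs _ _ Cc Bv).
    have [_ Cc1] := pC _ Cc.
    have -> : v = (c - 1) + (v + (1 - c)) by lra.
    by rewrite (Cs _ _ Cc1 Bv).
rewrite {}E measure_fin_bigcup//; last 2 first.
- move=> c c' [Cc +] [Cc' +] [v [Yc Yc']]; rewrite /= !in_itv/= => c01 c01'.
  have vis d : C d -> (Y1 d `|` Y2 d) v -> v - s v = d \/ v - s v = d - 1.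
    move=> Cd [[_ /= Bv]|[_ /= Bv]].
      by left; have := Cs _ _ Cd Bv; have -> : d + (v - d) = v by [lra]; lra.
    right; have := Cs _ _ (proj2 (pC _ Cd)) Bv.
    by have -> : d - 1 + (v + (1 - d)) = v by [lra]; lra.
  have := vis _ Cc Yc; have := vis _ Cc' Yc'; lra.
- by move=> c _; apply: measurableU; [exact: mY1|exact: mY2].
rewrite fsbig_finite//=.
rewrite (eq_big_seq (fun=> leb B)); last first.
  move=> c; rewrite in_fset_set// => /set_mem[_ c01].
  by apply: mY; move: c01; rewrite /= in_itv.
by rewrite big_const_seq count_predT -Monoid.iteropE mule_natl.
Qed.

End Occupation.

Section Density.
Context {R : realType} (T : R) (s : R -> R).
Hypothesis sP : loc_path T s.
Hypothesis T1 : T <= 1.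
Hypothesis ms : measurable_fun setT s.
Notation leb := (@lebesgue_measure R).

Let C := crossing s.
Let f := crossing_number s.

(** The levels at which [q - t] can serve as radius in [right_structure]. Fixing the right end
    instead of the radius makes this set an interval with constant [C], and rational [q] suffice to
    cover []0, T[]. *)
Definition regular_piece (q : R) : set R := [set t | [/\ 0 < t < q, q <= T,
  forall v, t < s v < q -> C t (v - s v) &
  forall c, C t c -> forall u, t < u < q -> s (c + u) = u]].

Lemma regular_piece_crossing q t u : regular_piece q t -> t < u < q -> C u = C t.
Proof.
move=> [tq qT vC Cv] tu; apply: (crossing_right s t (q - t)); rewrite subrKC//.
Qed.

Lemma regular_piece_const q t u : regular_piece q t -> regular_piece q u -> C t = C u.
Proof.
move=> Et Eu; case: (ltgtP t u) => [tu|ut|->//].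
- by rewrite (regular_piece_crossing q t u)//; case: Eu; lra.
- by rewrite (regular_piece_crossing q u t)//; case: Et; lra.
Qed.

Lemma measurable_regular_piece q : measurable (regular_piece q).
Proof.
apply: is_interval_measurable => x y Ex Ey z.
rewrite le_eqVlt => /andP[/orP[/eqP <-//|xz] zy].
have zq : z < q by case: Ey; lra.
have CE : C z = C x by apply: (regular_piece_crossing q) => //; rewrite xz zq.
case: Ex => xq qT vC Cv; split=> //; first lra.
- by move=> v zv; rewrite CE; apply: vC; lra.
- by move=> c; rewrite CE => Cc u zu; apply: Cv => //; lra.
Qed.

Lemma regular_piece_cover t : 0 < t < T ->
  exists r : rat, regular_piece (ratr r) t.
Proof.
move=> tT; have [h h0 [hT vC Cv]] := right_structure T s sP t tT.
have [r] : exists q : rat, ratr q \in `]t, t + h[ by apply: rat_in_itvoo; lra.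
rewrite in_itv/= => rt; exists r; split; [lra|lra| |].
- by move=> v tv; apply: vC; lra.
- by move=> c Cc u tu; apply: Cv => //; lra.
Qed.

Lemma measurable_occupation B : measurable B ->
  measurable (`[0%R, 1[%classic `&` s @^-1` B : set R).
Proof. by move=> mB; apply: measurableI => //; rewrite -[_ @^-1` _]setTI; exact: ms. Qed.

(** Visits to a single level are spaced, by [same_line] with both levels equal to [t]. *)
Lemma occupation_set1 t : 0 < t < T -> leb (`[0, 1[ `&` s @^-1` [set t]) = 0%E.
Proof.
move=> tT; apply: countable_lebesgue_measure0; apply: finite_set_countable.
rewrite setIC; pose m := Num.min t (T - t) / 2.
have m0 : 0 < m by rewrite divr_gt0// lt_min; lra.
have [? ?] : m <= t / 2 /\ m <= (T - t) / 2.
  by rewrite /m !ler_pM2r ?invr_gt0//; split; rewrite ge_min lexx ?orbT.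
apply: (spaced_finite m) => // x y /= sx sy xy.
rewrite leNgt; apply/negP => H.
have := same_line T s sP x y t t xy; lra.
Qed.

Lemma occupation_regular_piece q B : measurable B -> B `<=` regular_piece q ->
  leb (`[0, 1[ `&` s @^-1` B) = (\int[leb]_(t in B) (f t)%:E)%E.
Proof.
move=> mB BE.
have [[t0 Et0]|nE] := pselect (exists t, regular_piece q t); last first.
  have -> : B = set0 by apply/seteqP; split=> // t /BE Et; apply: nE; exists t.
  by rewrite preimage_set0 setI0 measure0 integral_set0.
have Bf t : B t -> C t = C t0 by move=> /BE Et; exact: (regular_piece_const q).
rewrite (eq_integral (cst (f t0)%:E)); last first.
  by move=> t /set_mem Bt; rewrite /f /crossing_number -/C (Bf t Bt).
rewrite integral_cst// -[X in (_ = _ * X)%E]/(leb B).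
(* The structure at a level controls only levels strictly above it, so the least level [a] of the
   piece is removed; it is negligible on both sides. If there is no least level, the default [0] is
   not in [B]. *)
have [a aP] : exists a, forall t, B t -> t != a -> exists2 u, regular_piece q u & u < t.
  have [[a Ea am]|H] := pselect (exists2 a, regular_piece q a &
      forall t, regular_piece q t -> a <= t).
    exists a => t /BE Et ta; exists a => //; rewrite lt_neqAle eq_sym ta.
    exact: am.
  exists 0 => t /BE Et _; apply: contrapT => nu; apply: H; exists t => // u Eu.
  by rewrite leNgt; apply/negP => ut; apply: nu; exists u.
have tT t : B t -> 0 < t < T by move=> /BE []; lra.
have mBa : measurable (B `\` [set a]) by exact: measurableD.
have mBa' : measurable (B `&` [set a]) by exact: measurableI.
have B_a : B = (B `\` [set a]) `|` (B `&` [set a]) by rewrite setUC setUIDK.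
have leb_a : leb (B `&` [set a]) = 0%E.
  apply: countable_lebesgue_measure0; apply: finite_set_countable.
  by apply: (sub_finite_set _ (finite_set1 a)); exact: subIsetr.
have occ_a : leb (`[0, 1[ `&` s @^-1` (B `&` [set a])) = 0%E.
  have [Ba|nBa] := pselect (B a); last first.
    have -> : B `&` [set a] = set0 by apply/seteqP; split=> // t [Bt ta]; apply: nBa; rewrite -ta.
    by rewrite preimage_set0 setI0 measure0.
  have -> : B `&` [set a] = [set a] by apply/seteqP; split=> [t []//|t ->].
  by apply: occupation_set1; exact: tT.
have -> : leb (`[0, 1[ `&` s @^-1` B) = leb (`[0, 1[ `&` s @^-1` (B `\` [set a])).
  rewrite [in LHS]B_a preimage_setU setIUr; apply: measureU0 => //;
    exact: measurable_occupation.
have -> : leb B = leb (B `\` [set a]) by rewrite [in LHS]B_a; exact: measureU0.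
rewrite (lebesgue_occupation s (C t0))//.
- by move=> t [/tT Bt _]; rewrite /= in_itv/=; have := T1; lra.
- exact: (crossing_periodic T s).
- by apply: (finite_crossing T s) => //; case: Et0; lra.
- move=> c u Cc [Bu /eqP ua]; have [t Et tu] := aP u Bu ua.
  case: (Et) => tq qT vC Cv; apply: Cv; first by rewrite (regular_piece_const q t t0).
  by have [] := BE _ Bu; lra.
- move=> v [Bu /eqP ua]; have [t Et tu] := aP _ Bu ua.
  rewrite -(regular_piece_const q t t0)//; case: Et => tq qT vC Cv; apply: vC.
  by have [] := BE _ Bu; lra.
Qed.

Definition rational_piece (k : nat) : set R :=
  if (choice.unpickle k : option rat) is Some r then regular_piece (ratr r) else set0.

Lemma rational_piece_cover A : A `<=` `]0, T[ ->
  A = \bigcup_k (A `&` rational_piece k).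
Proof.
move=> A0T; apply/seteqP; split=> [t At|t [k _ []]//].
have [|r Er] := regular_piece_cover t; first by move: (A0T _ At); rewrite /= in_itv.
exists (choice.pickle r); first exact: I.
by split; [exact: At|rewrite /rational_piece choice.pickleK; exact: Er].
Qed.

Lemma measurable_rational_piece k : measurable (rational_piece k).
Proof.
by rewrite /rational_piece; case: choice.unpickle => [r|//]; exact: measurable_regular_piece.
Qed.

Lemma measurable_crossing_number A : measurable A -> A `<=` `]0, T[ ->
  measurable_fun A (fun t => (f t)%:E).
Proof.
move=> mA A0T; apply/measurable_EFinP; rewrite (rational_piece_cover A A0T).
apply/measurable_fun_bigcup => [k|k].
  by apply: measurableI => //; exact: measurable_rational_piece.
rewrite /rational_piece; case: (choice.unpickle k) => [r|]; last by rewrite setI0; exact: measurable_fun_set0.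
have [[t0 Et0]|nE] := pselect (exists t, regular_piece (ratr r) t); last first.
  have -> : regular_piece (ratr r) = set0 by apply/seteqP; split=> // t Et; apply: nE; exists t.
  by rewrite setI0; exact: measurable_fun_set0.
apply: (eq_measurable_fun (cst (f t0))) => [t /set_mem[_ Et]|]; last exact: measurable_cst.
by rewrite /f /crossing_number -/C (regular_piece_const _ _ _ Et0 Et).
Qed.

Lemma occupation_density A : measurable A -> A `<=` `]0, T[ ->
  leb (`[0, 1[ `&` s @^-1` A) = (\int[leb]_(t in A) (f t)%:E)%E.
Proof.
move=> mA A0T; have mE := measurable_rational_piece.
pose F k := A `&` rational_piece k.
have AF : A = \bigcup_k F k by exact: rational_piece_cover.
have mF k : measurable (F k) by exact: measurableI.
pose G := seqDU F.
have mG k : measurable (G k).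
  by apply: measurableD => //; apply: bigsetU_measurable.
have AG : A = \bigcup_k G k by rewrite AF seqDU_bigcup_eq.
have occG k : leb (`[0, 1[ `&` s @^-1` (G k)) = (\int[leb]_(t in G k) (f t)%:E)%E.
  have GE : G k `<=` rational_piece k.
    by move=> t Gt; have [_] : F k t := subset_seqDU Gt.
  case kr : (choice.unpickle k : option rat) => [r|]; first last.
    have -> : G k = set0 by apply/seteqP; split=> // t /GE; rewrite /rational_piece kr.
    by rewrite preimage_set0 setI0 measure0 integral_set0.
  apply: (occupation_regular_piece (ratr r)) => // t /GE.
  by rewrite /rational_piece kr.
rewrite AG ge0_integral_bigcup//; last 3 first.
- by rewrite -AG; exact: measurable_crossing_number.
- by move=> t _; rewrite lee_fin.
- exact: trivIset_seqDU.
rewrite preimage_bigcup setI_bigcupr measure_bigcup//; last 2 first.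
- by move=> k _; exact: measurable_occupation.
- move=> i j _ _ [v [[_ Gi] [_ Gj]]].
  by apply: (@trivIset_seqDU _ F i j I I); exists (s v).
rewrite (eq_eseriesl (Q := xpredT)); last by move=> k; rewrite in_setT.
by apply: eq_eseriesr => k _; exact: occG.
Qed.

Lemma cadlag_crossing_number : cadlag_on T f.
Proof.
move=> t tT; split.
- have [h h0 [hT vC Cv]] := right_structure T s sP t tT.
  apply: cvg_near_cst; near=> u.
  rewrite /f /crossing_number (crossing_right s t h vC Cv u)//.
  by apply/andP; split; near: u; [exact: nbhs_right_gt|apply: nbhs_right_lt; lra].
- have [h h0 hP] := crossing_left T s t sP tT.
  apply/cvg_ex; exists (f (t - h / 2)); apply: cvg_near_cst; near=> u.
  have uh : t - h < u < t.
    by apply/andP; split; near: u; [apply: nbhs_left_gt; lra|exact: nbhs_left_lt].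
  rewrite /f /crossing_number; congr (count01 _)%:R.
  by apply/seteqP; split; apply: hP; lra.
Unshelve. all: by end_near.
Qed.

End Density.

(** The default [-1] lies outside [[0, T]], as the coding of infinity in [loc_path] requires. *)
Definition finite_value {R : realType} (x : \bar R) : R :=
  if x == +oo%E then -1 else fine x.

Section LawOfPath.
Context {R : realType}.
Notation leb := (@lebesgue_measure R).

Lemma measurable_finite_value (l : R -> \bar R) : measurable_fun setT l ->
  measurable_fun setT (fun v => finite_value (l v)).
Proof.
move=> ml; apply: measurable_fun_ifT => //=.
- have moo := ml measurableT [set +oo%E] (emeasurable_set1 _).
  apply: (measurable_fun_bool true).
  rewrite [X in measurable X](_ : _ = setT `&` l @^-1` [set +oo%E])//.
  by apply/seteqP; split=> v /= [_ /eqP].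
- by apply: (measurableT_comp _ ml); exact: fine_measurable.
Qed.

Variables (T : R) (l : R -> \bar R) (F : probability (\bar R) R).
Hypothesis T0 : 0 < T.
Hypothesis T1 : T <= 1.
Hypothesis ml : measurable_fun setT l.
Hypothesis lT : forall v, l v = +oo%E \/ (0%:E <= l v <= T%:E)%E.
Hypothesis sP : loc_path T (fun v => finite_value (l v)).
Hypothesis FE : forall B, measurable B -> F B = leb (`[0, 1[ `&` l @^-1` B).

Let s v := finite_value (l v).

Lemma finite_valueP v : (l v = +oo%E /\ s v = -1) \/ (l v = (s v)%:E /\ 0 <= s v <= T).
Proof.
rewrite /s /finite_value; case: (lT v) => [->|]; first by left; rewrite eqxx.
by case: (l v) => [r rT|/andP[_]|/andP[+ _]]; [right|rewrite leye_eq|rewrite leeNy_eq].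
Qed.

Lemma preimage_finite_value (A : set R) : A `<=` `[0, T] ->
  l @^-1` (EFin @` A) = s @^-1` A.
Proof.
move=> AT; apply/seteqP; split=> v /=.
- by move=> [a Aa al]; case: (finite_valueP v) => -[]; rewrite -al// => -[<-].
- move=> As; have := AT _ As; rewrite /= in_itv/= => s0.
  case: (finite_valueP v) => -[lv sv]; last by exists (s v).
  by move: s0; rewrite sv; lra.
Qed.

Lemma law_finite (A : set R) : measurable A -> A `<=` `[0, T] ->
  F (EFin @` A) = leb (`[0, 1[ `&` s @^-1` A).
Proof.
by move=> mA AT; rewrite FE ?preimage_finite_value//; exact: measurable_image_EFin.
Qed.

Lemma sub_itvcc (A : set R) : A `<=` `]0, T[ -> A `<=` `[0, T].
Proof. by move=> AT t /AT; rewrite /= !in_itv/=; lra. Qed.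

Lemma law_absolutely_continuous : P_T T F.
Proof.
split.
- rewrite FE; last first.
    apply: measurableC; apply: measurableU; last exact: emeasurable_set1.
    by apply: measurable_image_EFin; exact: measurable_itv.
  rewrite (_ : _ `&` _ = set0) ?measure0//; apply/seteqP; split=> // v [_ /=]; apply.
  case: (finite_valueP v) => -[lv sv]; first by right.
  by left; exists (s v) => //=; rewrite in_itv.
- move=> A mA AT A0; rewrite law_finite//; last exact: sub_itvcc.
  rewrite (occupation_density T _ sP T1)//; last exact: measurable_finite_value.
  apply: null_set_integral => //.
  by apply: (measurable_crossing_number T _ sP).
Qed.

Lemma law_in_E_T : E_T T F.
Proof.
split; first exact: law_absolutely_continuous.
have ms := measurable_finite_value l ml.
exists (crossing_number s); split; first exact: (cadlag_crossing_number T s sP).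
split.
  move=> A mA AT; rewrite law_finite//; last exact: sub_itvcc.
  exact: (occupation_density T s sP T1 ms).
split; first by move=> t tT; exists (count01 (crossing s t)).
split.
  move=> t1 t2 t10 t12 t2T; apply: ge_ereal_sup => _ [n [x [xi [xS ->]]]].
  rewrite lee_fin.
  have := crossing_variation T s sP t1 t2 n x 0 t10 t2T xi xS (or_introl erefl).
  by rewrite mulr0 addr0.
move=> FT nF.
have [v visv] : exists v, 0 <= s v <= T.
  apply: contrapT => nv; move: FT; rewrite law_finite//.
  rewrite (_ : _ `&` _ = set0) ?measure0 ?ltxx//; apply/seteqP; split=> // v [_ /=].
  by rewrite in_itv/= => sv; apply: nv; exists v.
have full (A : set R) : measurable A -> A `<=` `[0, T] -> (forall v, A (s v)) ->
    F (EFin @` A) = 1%E.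
  move=> mA AT As; rewrite law_finite//.
  rewrite (_ : _ `&` _ = `[0, 1[%classic); last by apply/seteqP; split=> [w []//|w w01]; split.
  by rewrite lebesgue_measure_itv/= lte_fin ltr01 -EFinB subr0.
split.
  move=> t tT.
  (* If every window is visible, excluding [F([0, t]) = 1] gives a value above [t] and excluding
     [F([t, T]) = 1] a value below [t]; periodicity then gives an upward crossing. *)
  have [[w nw]|allvis] := pselect (exists w, ~~ (0 <= s w <= T)).
    exact: (crossing_number_ge1_invisible T s sP t w v).
  have vis w : 0 <= s w <= T by apply: contrapT => /negP nw; apply: allvis; exists w.
  have [u hu] : exists u, t < s u <= T.
    apply: contrapT => nu; apply: nF; exists t; split=> //; left.
    apply: full => // [u|u]; rewrite /= !in_itv/=; first lra.
    apply/andP; split; first by case/andP: (vis u).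
    rewrite leNgt; apply/negP => tu; apply: nu; exists u; rewrite tu.
    by case/andP: (vis u).
  have [w hw] : exists w, ~~ (t < s w <= T).
    apply: contrapT => nu; apply: nF; exists t; split=> //; right.
    apply: full => // [w|w]; rewrite /= !in_itv/=; first lra.
    apply: contrapT => /negP H; apply: nu; exists w.
    by apply: contra H; lra.
  exact: (crossing_number_ge1 T s sP t w u).
move=> Foo t1 t2 t10 t12 t2T; apply: ge_ereal_sup => _ [n [x [xi [xS ->]]]].
have [w nw] : exists w, ~~ (0 <= s w <= T).
  apply: contrapT => nv; move: Foo; rewrite FE//.
  rewrite (_ : _ `&` _ = set0) ?measure0 ?ltxx//; apply/seteqP; split=> // w [_ /= lw].
  apply: nv; exists w; case: (finite_valueP w) => -[]; rewrite lw => // _ ->.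
  by apply/negP; lra.
rewrite lee_fin.
rewrite (eq_bigr (fun i => `|crossing_number s (x i.+1) - crossing_number s (x i)|)).
  have := crossing_variation T s sP t1 t2 n x 1 t10 t2T xi xS
    (or_intror (conj erefl (conj (ex_intro _ w nw) (ex_intro _ v visv)))).
  by rewrite mulr1; lra.
by move=> i _; congr `|_|; lra.
Qed.

End LawOfPath.

(** * Paths of an intrinsic location functional *)

Ltac rlra :=
  repeat match goal with h : @eq (extended _) _ _ |- _ => clear h end; lra.

Section PathOfFunction.
Context {R : realType} (H : set (R -> R)) (L : (R -> R) -> R -> R -> \bar R) (T : R).
Hypothesis HH : admissible_H H.
Hypothesis HL : intrinsic_location H L.
Hypothesis T0 : 0 < T.

Definition location_path (g : R -> R) (v : R) : \bar R := L (Defs.shift (- v) g) 0 T.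

Lemma location_range g : H g -> L g 0 T = +oo%E \/ (0%:E <= L g 0 T <= T%:E)%E.
Proof. by move=> Hg; have [_ [h _]] := HL; exact: h. Qed.

Lemma location_path_range g v : H g ->
  location_path g v = +oo%E \/ (0%:E <= location_path g v <= T%:E)%E.
Proof. by move=> Hg; apply: location_range; exact: (proj2 HH). Qed.

Section FixedFunction.
Variable g : R -> R.
Hypothesis Hg : H g.

Let s v := finite_value (location_path g v).

Lemma location_pathE v : L g (- v) (T - v) = (location_path g v + (- v)%:E)%E.
Proof.
have [_ [_ [h _]]] := HL.
have vT : - v < T - v by have := T0; lra.
rewrite (h g (- v) (T - v) (- v) Hg vT) /location_path; congr (L _ _ _ + _)%E; lra.
Qed.

Lemma location_path_visible v : 0 <= s v <= T -> L g (- v) (T - v) = (s v - v)%:E.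
Proof.
move=> sv; rewrite location_pathE.
case: (finite_valueP T _ (fun u => location_path_range g u Hg) v) => -[lv sE].
  by exfalso; clear lv; move: sv; rewrite /s sE; lra.
by rewrite lv EFinB.
Qed.

Lemma location_path_finite v y : L g (- v) (T - v) = y%:E ->
  0 <= s v <= T /\ y = s v - v.
Proof.
rewrite location_pathE.
case: (finite_valueP T _ (fun u => location_path_range g u Hg) v) => -[lv sv].
  by rewrite lv.
by rewrite lv -EFinD => -[<-].
Qed.

Lemma location_path_not_infinite v : L g (- v) (T - v) != +oo%E ->
  exists y, L g (- v) (T - v) = y%:E.
Proof.
move=> Loo; have [_ [h _]] := HL.
have vT : - v < T - v by have := T0; lra.
case: (h g _ _ Hg vT) => [Lo|]; first by rewrite Lo eqxx in Loo.
case: (L g _ _) Loo => [r _ _|//|_ /andP[+ _]]; first by exists r.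
by rewrite leeNy_eq.
Qed.

(** The windows at [v] and [w] are compared through their intersection [[-v, T - w]]: (iv) passes a
    location lying there to the intersection, and (v) then makes the other window visible. If the
    location moved the wrong way in [lp_mono], both values would lie in the intersection and agree
    by (iv). *)
Lemma loc_path_location : loc_path T s.
Proof.
have [_ [_ [_ [h4 h5]]]] := HL.
split.
- move=> v; rewrite /s /location_path; congr (finite_value (L _ 0 T)).
  apply/funext => x; rewrite /Defs.shift -(proj1 HH g Hg); congr g; rlra.
- move=> v w vw sv sw; rewrite leNgt; apply/negP => lt.
  have Lv := location_path_visible v sv; have Lw := location_path_visible w sw.
  have E1 := h4 g (- v) (T - v) (- v) (T - w) Hg.
  have E2 := h4 g (- w) (T - w) (- v) (T - w) Hg.
  have : (s v - v)%:E = (s w - w)%:E.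
    by rewrite -Lv -Lw -E1 ?Lv ?lee_fin ?E2 ?Lw ?lee_fin//; rlra.
  by move=> [?]; rlra.
- move=> v w vw wT sv svw.
  have Lv := location_path_visible v sv.
  have E1 : L g (- v) (T - w) = (s v - v)%:E.
    by rewrite -Lv; apply: h4; rewrite ?Lv ?lee_fin//; rlra.
  have [|y Ly] := location_path_not_infinite w.
    by apply: (h5 g _ _ (- v) (T - w)); rewrite ?E1//; rlra.
  have [sw yE] := location_path_finite w y Ly; split=> //.
  case: (leP (w - v) (s w)) => H1; [left|by right].
  have : L g (- v) (T - w) = L g (- w) (T - w).
    by apply: h4; rewrite ?Ly ?lee_fin//; rlra.
  by rewrite E1 Ly => -[]; rlra.
- move=> v w vw wT sw dw.
  have Lw := location_path_visible w sw.
  have E1 : L g (- v) (T - w) = (s w - w)%:E.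
    by rewrite -Lw; apply: h4; rewrite ?Lw ?lee_fin//; rlra.
  have [|y Ly] := location_path_not_infinite v.
    by apply: (h5 g _ _ (- v) (T - w)); rewrite ?E1//; rlra.
  have [sv yE] := location_path_finite v y Ly; split=> //.
  case: (leP (s v) (T - (w - v))) => H1; [left|by right].
  have : L g (- v) (T - w) = L g (- v) (T - v).
    by apply: h4; rewrite ?Ly ?lee_fin//; rlra.
  by rewrite E1 Ly => -[]; rlra.
Qed.

End FixedFunction.
End PathOfFunction.

(** * Measurability of the location along a process *)

Lemma measurable_cyl_preimage {R : realType} d (S : measurableType d)
    (X : S -> R -> R) (A : set (R -> R)) :
  (forall t, measurable_fun setT (fun x => X x t)) -> cyl_sets A ->
  measurable (X @^-1` A).
Proof.
move=> mX; apply: (@smallest_sub _ _ _ [set A | measurable (X @^-1` A)]).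
- split => [|B mB|B mB] /=.
  + by rewrite preimage_set0.
  + by rewrite setTD preimage_setC; apply: measurableC; exact: mB.
  + by rewrite preimage_bigcup; apply: bigcup_measurable => k _; exact: mB.
- by move=> _ [t _ [B mB <-]] /=; rewrite -[_ @^-1` _]setTI; exact: mX.
Qed.

Lemma measurable_location {R : realType} (H : set (R -> R)) L d
    (S : measurableType d) (X : S -> R -> R) (a b : R) : a < b ->
  intrinsic_location H L -> (forall x, H (X x)) ->
  (forall t, measurable_fun setT (fun x => X x t)) ->
  measurable_fun setT (fun x => L (X x) a b : \bar R).
Proof.
move=> ab [mL _] HX mX _ B mB; rewrite setTI.
have [A [cA HA]] := mL a b ab B mB.
rewrite (_ : _ @^-1` B = X @^-1` A); first by apply: (measurable_cyl_preimage _ _ _ _ mX cA).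
apply/seteqP; split=> x /= Bx.
  by have [] : (H `&` A) (X x) by rewrite -HA; split; [exact: HX|exact: Bx].
have [] // : (H `&` [set g | B (L g a b)]) (X x).
by rewrite HA; split; [exact: HX|exact: Bx].
Qed.

(** By continuity, [Y w x] is the limit of [Y w (r n x)], where [r n x] is the grid point of mesh
    [1 / n.+1] just below [x]; for fixed [n] only countably many measurable functions of [w]
    occur. *)
Lemma measurable_fun_section_continuous {R : realType} d (S : measurableType d)
    (Y : S -> R -> R) :
  (forall t, measurable_fun setT (fun w => Y w t)) -> (forall w, continuous (Y w)) ->
  measurable_fun setT (fun p : S * R => Y p.1 p.2).
Proof.
move=> mY cY.
pose r (n : nat) (x : R) : R := (Num.floor (n.+1%:R * x))%:~R / n.+1%:R.
apply: (@measurable_fun_cvg _ _ _ _ (fun n p => Y p.1 (r n p.2))).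
- move=> n _ B mB; rewrite setTI.
  pose P (k : int) : set (S * R) := [set w | B (Y w (k%:~R / n.+1%:R))] `*`
    [set x | Num.floor (n.+1%:R * x) = k].
  have mP k : measurable (P k).
    apply: measurableX.
      by rewrite -[X in measurable X]setTI; apply: (mY (k%:~R / n.+1%:R)).
    rewrite (_ : [set x | _] = `[k%:~R / n.+1%:R, (k + 1)%:~R / n.+1%:R[%classic).
      exact: measurable_itv.
    apply/seteqP; split=> x /=; rewrite in_itv/= ler_pdivrMr// ltr_pdivlMr// mulrC.
      by move/eqP; rewrite floor_eq.
    by rewrite -floor_eq => /eqP.
  rewrite [X in measurable X](_ : _ = (\bigcup_(i : nat) P (Posz i)) `|`
      (\bigcup_(i : nat) P (Negz i))).
    by apply: measurableU; exact: bigcup_measurable.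
  apply/seteqP; split=> [[w x] /= Bw|[w x] [|] [i _ [/= Bw kE]]].
  - by case kE : (Num.floor (n.+1%:R * x)) => [i|i]; [left|right]; exists i => //;
      split=> //=; rewrite -kE.
  - by rewrite /r kE.
  - by rewrite /r kE.
- move=> [w x] _ /=.
  have rx : r n x @[n --> \oo] --> x.
    apply/cvgrPdist_le => e e0; near=> n.
    have n0 : (0 : R) < n.+1%:R by [].
    have /andP[f1 f2] := floor_itv (n.+1%:R * x).
    have xr : 0 <= x - r n x <= n.+1%:R^-1.
      rewrite subr_ge0 ler_pdivrMr// [x * _]mulrC f1/= lerBlDr -[_^-1]mul1r -mulrDl.
      by rewrite ler_pdivlMr// [x * _]mulrC addrC ltW// -[1]/(1%:~R) -rmorphD.
    rewrite ger0_norm; last by case/andP: xr.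
    apply: le_trans (proj2 (andP xr)) _.
    by apply: ltW; near: n; exact: (near_infty_natSinv_lt (PosNum e0)).
  exact: (@continuous_cvg nat R R \oo _ (r^~ x) (Y w) x (cY w x) rx).
Unshelve. all: by end_near.
Qed.

(** * Mixtures and finite partitions *)

Lemma probability_of_measure {R : realType} d (S : measurableType d)
    (mu : {measure set S -> \bar R}) : mu setT = 1%E ->
  exists P : probability S R, forall A, P A = mu A.
Proof.
move=> mu1; pose P0 : probability S R := dirac point.
exists (mnormalize mu P0) => A; rewrite /= /mnormalize mu1 /=.
by rewrite onee_eq0/= invr1 mule1.
Qed.

Lemma mixture_probability {R : realType} d (S : measurableType d) n
    (Fs : 'I_n -> probability S R) (w : 'I_n -> R) :
  (forall i, 0 <= w i) -> \sum_(i < n) w i = 1 ->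
  exists G : probability S R, forall B, measurable B ->
    G B = (\sum_(i < n) (w i)%:E * Fs i B)%E.
Proof.
move=> w0 w1.
have [mu muE] : exists mu : {measure set S -> \bar R}, forall B, measurable B ->
    mu B = (\sum_(i < n) (w i)%:E * Fs i B)%E.
  elim: n Fs w w0 {w1} => [|n IH] Fs w w0.
    by exists (@mzero _ S R) => B _; rewrite big_ord0.
  have [mu muE] := IH (Fs \o widen_ord (leqnSn n)) (w \o widen_ord (leqnSn n))
    (fun i => w0 _).
  exists (measure_add mu (mscale (NngNum (w0 ord_max)) (Fs ord_max))) => B mB.
  by rewrite [LHS]measure_addE muE// big_ord_recr.
have [|G GE] := probability_of_measure _ S mu.
  rewrite muE// (eq_bigr (fun i => (w i)%:E)) ?sumEFin ?w1// => i _.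
  by rewrite probability_setT mule1.
by exists G => B mB; rewrite GE muE.
Qed.

Lemma pushforward_probability {R : realType} d d' (S : measurableType d)
    (S' : measurableType d') (P : probability S R) (f : S -> S') :
  measurable_fun setT f ->
  exists Q : probability S' R, forall B, Q B = P (f @^-1` B).
Proof.
move=> mf; pose mu : {measure set S' -> \bar R} := pushforward P f.
have [|Q QE] := probability_of_measure _ S' (mu mf).
  by rewrite /mu /= /pushforward preimage_setT probability_setT.
by exists Q => B; rewrite QE.
Qed.

Lemma unit_interval_probability {R : realType} :
  exists U : probability (measurableTypeR R) R, forall B : set R,
    U B = (@lebesgue_measure R) (`[0, 1[ `&` B).
Proof.
have mI : measurable (`[0, 1[%classic : set R) by exact: measurable_itv.
pose mu : {measure set (measurableTypeR R) -> \bar R} := mrestr (@lebesgue_measure R) mI.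
have [|U UE] := probability_of_measure _ _ mu.
  rewrite /mu /= /mrestr setTI.
  by rewrite [LHS]lebesgue_measure_itv/= lte_fin ltr01 -EFinB subr0.
by exists U => B; rewrite UE /mu /= /mrestr setIC.
Qed.

Section ValuePartition.
Context {R : realType} d (S : measurableType d) (D : set S).
Hypothesis mD : measurable D.

(** Each function in turn cuts [D] into bands of height [eps]; the old index and the band are packed
    as [kappa x * K + b x] with [b x < K]. *)
Lemma value_partition k (phi : 'I_k -> S -> R) (M eps : R) :
  (forall j, measurable_fun D (phi j)) ->
  (forall j x, D x -> `|phi j x| <= M) -> 0 < eps ->
  exists N (kappa : S -> nat), [/\ forall x, D x -> (kappa x < N)%N,
    forall n, measurable (D `&` kappa @^-1` [set n]) &
    forall x y, D x -> D y -> kappa x = kappa y ->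
      forall j, `|phi j x - phi j y| <= eps].
Proof.
move=> + + eps0; elim: k phi => [|k IH] phi mphi bphi.
  exists 1%N, (fun=> 0%N); split=> // [n|x y _ _ _ []//].
  case: n => [|n].
    by rewrite (_ : _ `&` _ = D)//; apply/seteqP; split=> [x []//|x].
  by rewrite (_ : _ `&` _ = set0)//; apply/seteqP; split=> [x []//|x].
have [N [kappa [kN mk kP]]] := IH (phi \o lift ord0)
  (fun j => mphi _) (fun j => bphi _).
pose b x := Num.truncn ((phi ord0 x + M) / eps).
pose K := (Num.truncn ((M + M) / eps)).+1.
have b0 x : D x -> 0 <= (phi ord0 x + M) / eps.
  move=> Dx; apply: divr_ge0; last exact: ltW.
  by have := bphi ord0 x Dx; rewrite ler_norml; lra.
have bK x : D x -> (b x < K)%N.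
  move=> Dx; rewrite ltnS; apply: le_truncn; rewrite ler_pM2r ?invr_gt0//.
  by have := bphi ord0 x Dx; rewrite ler_norml; lra.
exists (N * K)%N, (fun x => kappa x * K + b x)%N; split.
- move=> x Dx; have := kN x Dx; have := bK x Dx.
  rewrite -(ltn_pmul2r (m := K))// => ? ?; nia.
- move=> n.
  have -> : D `&` (fun x => kappa x * K + b x)%N @^-1` [set n] =
      (D `&` kappa @^-1` [set (n %/ K)%N]) `&`
      (D `&` phi ord0 @^-1` `[(n %% K)%:R * eps - M, (n %% K).+1%:R * eps - M[).
    have bE x : D x -> (phi ord0 @^-1` `[(n %% K)%:R * eps - M, (n %% K).+1%:R * eps - M[) x
        <-> b x = (n %% K)%N.
      move=> Dx; rewrite /= in_itv/= lerBlDr ltrBrDr -ler_pdivlMr// -ltr_pdivrMr//.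
      by rewrite -truncn_eq ?b0//; split => /eqP.
    apply/seteqP; split=> x.
    + move=> [Dx /= nE]; have bx := bK x Dx; split; split=> //.
        by rewrite /= -nE divnMDl// divn_small// addn0.
      by apply/(bE x Dx); rewrite -nE modnMDl modn_small.
    + move=> [[Dx /= kx] [_ /(bE x Dx) bx]]; split=> //=.
      by rewrite kx bx -divn_eq.
  apply: measurableI => //; exact: mphi.
- move=> x y Dx Dy xy j.
  have bxy : b x = b y.
    by rewrite -(modn_small (bK _ Dx)) -(modn_small (bK _ Dy)) -(modnMDl (kappa x)) xy modnMDl.
  have kxy : kappa x = kappa y by move: xy; rewrite bxy => /addIn /eqP; rewrite eqn_pmul2r// => /eqP.
  have [->|] := eqVneq j ord0; last first.
    by rewrite eq_sym => /unlift_some[i -> _]; exact: (kP x y Dx Dy kxy i).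
  have := truncn_itv (b0 _ Dx); have := truncn_itv (b0 _ Dy).
  rewrite -/(b x) -/(b y) bxy -natr1 !ler_pdivlMr// !ltr_pdivrMr// mulrDl mul1r ler_norml.
  lra.
Qed.

Section Cells.
Variables (N : nat) (kappa : S -> nat).
Hypothesis kN : forall x, D x -> (kappa x < N)%N.
Hypothesis mk : forall n, measurable (D `&` kappa @^-1` [set n]).

Let E n := D `&` kappa @^-1` [set n].

Let mE n : measurable (E n). Proof. exact: mk. Qed.

Let DE : D = \big[setU/set0]_(i < N) E i.
Proof.
rewrite -bigcup_mkord; apply/seteqP; split=> [x Dx|x [n _ [Dx _]]]; last exact: Dx.
by exists (kappa x) => //=; exact: kN.
Qed.

Let tE : trivIset setT E.
Proof. by move=> i j _ _ [x [[_ <-] [_ <-]]]. Qed.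

Lemma sum_value_partition (mu : probability S R) : mu D = 1%E ->
  \sum_(n < N) fine (mu (E n)) = 1.
Proof.
move=> mu1; apply: EFin_inj; rewrite -sumEFin -mu1 [in RHS]DE measure_bigsetU//.
by apply: eq_bigr => n _; rewrite fineK//; apply: fin_num_measure.
Qed.

Lemma value_partition_points : D !=set0 -> exists b : nat -> S,
  (forall n, D (b n)) /\ forall x, D x -> kappa (b (kappa x)) = kappa x.
Proof.
move=> [x0 Dx0].
have bP n : exists y, D y /\ forall x, D x -> kappa x = n -> kappa y = n.
  have [[x [Dx kx]]|nx] := pselect (exists x, D x /\ kappa x = n); first by exists x.
  by exists x0; split=> // x Dx kx; exfalso; apply: nx; exists x.
have [b bb] := choice bP; exists b; split=> [n|x Dx]; first by case: (bb n).
by case: (bb (kappa x)) => _ /(_ x Dx erefl).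
Qed.

Lemma integral_value_partition (mu : probability S R) (phi : S -> R) (M eps : R)
    (b : nat -> S) :
  mu D = 1%E -> measurable_fun D phi -> (forall x, D x -> `|phi x| <= M) ->
  (forall x, D x -> `|phi x - phi (b (kappa x))| <= eps) ->
  exists2 I : R, (\int[mu]_(x in D) (phi x)%:E = I%:E)%E &
    `|I - \sum_(n < N) phi (b n) * fine (mu (E n))| <= eps.
Proof.
move=> mu1 mphi bphi phib.
have int (A : set S) (f : S -> R) K : measurable A -> A `<=` D -> measurable_fun D f ->
    (forall x, D x -> `|f x| <= K) -> mu.-integrable A (EFin \o f).
  move=> mA AD mf fK; apply: measurable_bounded_integrable => //.
  - by rewrite (le_lt_trans (probability_le1 _ _))// ltry.
  - exact: (measurable_funS mD AD mf).
  - exists K; split; first exact: num_real.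
    by move=> y Ky x /AD Dx; apply: le_trans (fK x Dx) (ltW Ky).
have fmu n : mu (E n) \is a fin_num by exact: fin_num_measure.
have intE n : exists I : R, (\int[mu]_(x in E n) (phi x)%:E = I%:E)%E /\
    `|I - phi (b n) * fine (mu (E n))| <= eps * fine (mu (E n)).
  have iphi : mu.-integrable (E n) (EFin \o phi).
    by apply: (int _ _ M (mE n)) => // x [].
  have icst r : mu.-integrable (E n) (EFin \o cst r).
    by apply: (int _ _ `|r| (mE n)) => // x [].
  have JE := fineK (integrable_fin_num (mE n) iphi).
  have mE' := fineK (fmu n).
  set J := fine _ in JE; set m := fine _ in mE' *.
  exists J; split; first by rewrite JE.
  have up : J <= (phi (b n) + eps) * m.
    rewrite -lee_fin EFinM mE' JE -(integral_cst mu (mE n)).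
    apply: (le_integral (mE n) iphi (icst _)).
    move=> x /set_mem[Dx /= kx].
    suff : ((phi x)%:E <= (phi (b n) + eps)%:E)%E by []; rewrite lee_fin.
    by have := phib x Dx; rewrite kx ler_norml; clear JE mE'; lra.
  have lo : (phi (b n) - eps) * m <= J.
    rewrite -lee_fin EFinM mE' JE -(integral_cst mu (mE n)).
    apply: (le_integral (mE n) (icst _) iphi).
    move=> x /set_mem[Dx /= kx].
    suff : ((phi (b n) - eps)%:E <= (phi x)%:E)%E by []; rewrite lee_fin.
    by have := phib x Dx; rewrite kx ler_norml; clear JE mE'; lra.
  by clear JE mE'; rewrite ler_norml; lra.
have [I IE] := choice intE.
have mphi' : measurable_fun (\big[setU/set0]_(i < N) E i) (EFin \o phi).
  by rewrite -DE; exact/measurable_EFinP.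
have sI : (\int[mu]_(x in D) (phi x)%:E = (\sum_(n < N) I n)%:E)%E.
  rewrite [in LHS]DE (integral_bigsetU_EFin mu (F := fun i : 'I_N => E i))//; last 2 first.
  - exact: index_enum_uniq.
  - by move=> i j _ _ /tE ij; apply: val_inj; exact: ij.
  by rewrite -sumEFin; apply: eq_bigr => i _; case: (IE i).
exists (\sum_(n < N) I n) => //; rewrite -sumrB.
apply: le_trans (ler_norm_sum _ _ _) _.
rewrite -[leRHS]mulr1 -(sum_value_partition mu mu1) mulr_sumr.
by apply: ler_sum => i _; case: (IE i).
Qed.

End Cells.

End ValuePartition.

(** * Averages of path laws *)

Lemma measurable_KT {R : realType} (T : R) : measurable (KT T).
Proof.
apply: measurableU; last exact: emeasurable_set1.
by apply: measurable_image_EFin; exact: measurable_itv.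
Qed.

Section Averaging.
Context {R : realType} (H : set (R -> R)) (L : (R -> R) -> R -> R -> \bar R) (T : R).
Hypothesis HH : admissible_H H.
Hypothesis HL : intrinsic_location H L.
Hypothesis T0 : 0 < T.
Hypothesis T1 : T <= 1.
Context d (Omega : measurableType d) (P : probability Omega R) (X : Omega -> R -> R).
Hypothesis XP : periodic_stationary H P X.

Let l w v := location_path L T (X w) v.

Lemma measurable_joint_location :
  measurable_fun setT (fun p : Omega * R => l p.1 p.2).
Proof.
have [mX [cX [_ [HX _]]]] := XP.
apply: (measurable_location H L _ _ (fun p : Omega * R => Defs.shift (- p.2) (X p.1))) => //.
- by move=> p; exact: (proj2 HH).
- move=> t; have mY := measurable_fun_section_continuous _ _ X mX cX.
  apply: (measurableT_comp mY (g := fun p : Omega * R => (p.1, t - p.2))).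
  apply/measurable_fun_pair => //=.
  by apply: measurable_funB => //.
Qed.

Lemma measurable_path_location w : measurable_fun setT (l w).
Proof.
have [_ [cX [_ [HX _]]]] := XP.
apply: (measurable_location H L _ _ (fun v : R => Defs.shift (- v) (X w))) => //.
- by move=> v; exact: (proj2 HH).
- move=> t; apply: continuous_measurable_fun => v.
  apply: (@continuous_comp _ _ _ (fun v => t - v) (X w)); last exact: cX.
  by apply: cvgB; [exact: cvg_cst|exact: cvg_id].
Qed.

Lemma path_law (U : probability (measurableTypeR R) R) :
  (forall B, U B = (@lebesgue_measure R) (`[0, 1[ `&` B)) ->
  forall w, exists Q : probability (\bar R) R,
    (forall B, Q B = U (l w @^-1` B)) /\ E_T T Q.
Proof.
move=> UE w; have [_ [_ [_ [HX _]]]] := XP.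
have [Q QE] := pushforward_probability _ _ (measurableTypeR R) _ U (l w) (measurable_path_location w).
exists Q; split=> //.
apply: (law_in_E_T T (l w)) => //.
- exact: measurable_path_location.
- by move=> v; exact: (location_path_range H).
- exact: (loc_path_location H).
- by move=> B mB; rewrite QE UE.
Qed.

(** Fubini: in the other order of integration the shift [v] is fixed, and stationarity makes the
    inner probability independent of [v]. *)
Lemma average_path_law (U : probability (measurableTypeR R) R) (B : set (\bar R)) :
  measurable B ->
  measurable_fun setT (fun w => U (l w @^-1` B)) /\
  (\int[P]_w U (l w @^-1` B) = P [set w | B (L (X w) 0 T)])%E.
Proof.
move=> mB; have [mX [cX [_ [HX st]]]] := XP.
pose S : set (Omega * measurableTypeR R) := [set p | B (l p.1 p.2)].
have mS : measurable S.
  by have := measurable_joint_location measurableT B mB; rewrite setTI.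
have xS w : xsection S w = l w @^-1` B.
  by apply/seteqP; split=> v; rewrite /xsection /=; [move=> /set_mem|move=> h; apply/mem_set].
split.
  have := measurable_fun_xsection U mS.
  by apply: eq_measurable_fun => w _ /=; rewrite xS.
transitivity ((P \x U)%E S).
  by rewrite /product_measure1; apply: eq_integral => w _ /=; rewrite xS.
transitivity ((P \x^ U)%E S).
  by apply: product_measure_unique => // A1 A2 mA1 mA2; exact: product_measure2E.
rewrite /product_measure2.
rewrite (eq_integral (cst (P [set w | B (L (X w) 0 T)]))).
  transitivity (P [set w | B (L (X w) 0 T)] * U setT)%E; first exact: integral_cst.
  by rewrite probability_setT mule1.
move=> v _ /=.
(* Stationarity speaks of cylindrical sets only; [A] agrees with the event on [H], where all shifted
   paths lie. *)
have [A [cA HA]] := (proj1 HL) 0 T T0 B mB.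
have lA (g : R -> R) : H g -> B (L g 0 T) <-> A g.
  move=> Hg; split=> h.
    by have [] : (H `&` A) g by rewrite -HA; split.
  have [] // : (H `&` [set g | B (L g 0 T)]) g.
  by rewrite HA; split.
have := st (- v) A cA.
rewrite (_ : X @^-1` A = [set w | B (L (X w) 0 T)]); last first.
  by apply/seteqP; split=> w /= /lA; apply; exact: HX.
rewrite (_ : _ @^-1` A = ysection S v)//.
apply/seteqP; split=> w; rewrite /ysection /=.
- by move=> h; apply/mem_set/lA => //; apply: (proj2 HH).
- by move=> /set_mem h; apply/lA => //; apply: (proj2 HH).
Qed.

End Averaging.

(** * Convexity of the set of laws *)

Section Convexity.
Context {R : realType} (H : set (R -> R)) (L : (R -> R) -> R -> R -> \bar R) (T : R).
Hypothesis HL : intrinsic_location H L.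
Hypothesis T0 : 0 < T.

Lemma convex_location_laws : convex_laws (I_LT H L T).
Proof.
move=> F G lam [d1 [W1 [Pa [X1 [S1 FE]]]]] [d2 [W2 [Pb [X2 [S2 GE]]]]] lam01.
have [mX1 [cX1 [pX1 [HX1 st1]]]] := S1; have [mX2 [cX2 [pX2 [HX2 st2]]]] := S2.
(* The coin in the last coordinate selects the process to be run, with probabilities [lam] and
   [1 - lam]; the coordinate of the other process is frozen at [point]. *)
pose O := (W1 * W2 * bool)%type.
pose i1 (w : W1) : O := (w, point, true).
pose i2 (w : W2) : O := (point, w, false).
have mi1 : measurable_fun setT i1.
  by apply/measurable_fun_pair => //=; apply/measurable_fun_pair.
have mi2 : measurable_fun setT i2.
  by apply/measurable_fun_pair => //=; apply/measurable_fun_pair.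
have [Q1 QE1] := pushforward_probability _ _ _ _ Pa i1 mi1.
have [Q2 QE2] := pushforward_probability _ _ _ _ Pb i2 mi2.
pose Qs (i : 'I_2) := if i == ord0 then Q1 else Q2.
pose ws (i : 'I_2) := if i == ord0 then lam else 1 - lam.
have [||P PE] := mixture_probability _ _ 2 Qs ws.
- by move=> i; rewrite /ws; case: ifP => _; lra.
- by rewrite big_ord_recl big_ord1 /ws /=; lra.
have {}PE A : measurable A -> P A = (lam%:E * Pa (i1 @^-1` A) + (1 - lam)%:E * Pb (i2 @^-1` A))%E.
  by move=> mA; rewrite PE// big_ord_recl big_ord1 /ws /Qs /= -QE1 -QE2.
pose X (w : O) : R -> R := if w.2 then X1 w.1.1 else X2 w.1.2.
have mX t : measurable_fun setT (fun w => X w t).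
  rewrite (_ : (fun w => X w t) = fun w : O => if w.2 then X1 w.1.1 t else X2 w.1.2 t).
    apply: measurable_fun_ifT => //.
    - apply: (measurableT_comp (mX1 t) (g := fun w : O => w.1.1)).
      exact: (measurableT_comp measurable_fst measurable_fst).
    - apply: (measurableT_comp (mX2 t) (g := fun w : O => w.1.2)).
      exact: (measurableT_comp measurable_snd measurable_fst).
  by apply/funext => w; rewrite /X; case: (w.2).
have HX w : H (X w) by rewrite /X; case: (w.2); [exact: HX1|exact: HX2].
have [M ME] := pushforward_probability _ _ _ _ P _
  (measurable_location H L _ _ X 0 T T0 HL HX mX).
exists M; split; last first.
  move=> B mB; rewrite ME PE; last first.
    have := measurable_location H L _ _ X 0 T T0 HL HX mX measurableT B mB.
    by rewrite setTI.
  by rewrite FE// GE.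
exists _, O, P, X; split; last by move=> B mB; rewrite ME.
split=> //; split; last split; last split=> //.
- by move=> w; rewrite /X; case: (w.2).
- by move=> w t; rewrite /X; case: (w.2).
move=> c A cA.
rewrite !PE; last 2 first.
- have mXc t : measurable_fun setT (fun w : O => Defs.shift c (X w) t) by exact: mX.
  by apply: (measurable_cyl_preimage _ _ _ _ mXc cA).
- by apply: (measurable_cyl_preimage _ _ _ _ mX cA).
by congr (_ * _ + _ * _)%E; [exact: st1|exact: st2].
Qed.

End Convexity.

(** * Weak approximation of the law by finite mixtures of path laws *)

Lemma measurable_test_fun {R : realType} (T : R) (phi : \bar R -> R) :
  test_fun T phi -> measurable_fun (KT T) phi.
Proof.
move=> cphi; have mI : measurable (`[0, T]%classic : set R) by exact: measurable_itv.
apply/measurable_funU.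
- by apply: measurable_image_EFin.
- exact: emeasurable_set1.
split; last exact: measurable_fun_set1.
move=> _ B mB.
have mA := measurable_image_EFin (subspace_continuous_measurable_fun mI cphi mI mB).
suff -> : EFin @` `[0, T] `&` phi @^-1` B =
  EFin @` (`[0, T] `&` (fun x => phi x%:E) @^-1` B) by exact: mA.
apply/seteqP; split=> [_ [[x Ix <-] Bx]|_ [x [Ix Bx] <-]]; first by exists x.
by split=> //; exists x.
Qed.

Lemma bounded_test_fun {R : realType} (T : R) (phi : \bar R -> R) : 0 <= T ->
  test_fun T phi -> exists M, forall x, KT T x -> `|phi x| <= M.
Proof.
move=> T0 cphi.
have [a _ aP] := EVT_max T0 cphi; have [b _ bP] := EVT_min T0 cphi.
exists (`|phi a%:E| + `|phi b%:E| + `|phi +oo%E|) => _ [[x Ix <-]|->].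
- have := aP x Ix; have := bP x Ix.
  have := normr_ge0 (phi +oo%E); have := ler_norm (phi a%:E).
  have := ler_norm (- phi b%:E); rewrite normrN.
  have := normr_ge0 (phi a%:E); have := normr_ge0 (phi b%:E).
  by rewrite (ler_norml (phi x%:E)); lra.
- by have := normr_ge0 (phi a%:E); have := normr_ge0 (phi b%:E); lra.
Qed.

Section Laws.
Context {R : realType} (H : set (R -> R)) (L : (R -> R) -> R -> R -> \bar R) (T : R).
Hypothesis HH : admissible_H H.
Hypothesis HL : intrinsic_location H L.
Hypothesis T0 : 0 < T.
Hypothesis T1 : T <= 1.

(* The path law Q w is the law of the location in a uniformly shifted copy of
   the path w; F is the average of these. *)
Lemma law_disintegration (F : probability (\bar R) R) : I_LT H L T F ->
  exists d (Omega : measurableType d) (P : probability Omega R)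
    (Q : Omega -> probability (\bar R) R), (forall w, E_T T (Q w)) /\
    forall B, measurable B -> measurable_fun setT (fun w => Q w B) /\
      (\int[P]_w Q w B = F B)%E.
Proof.
move=> [d [S [P [X [XP FE]]]]]; have [U UE] := @unit_interval_probability R.
have [Q QP] := choice (path_law H L T HH HL T0 T1 _ S P X XP U UE).
exists d, S, P, Q; split=> [w|B mB]; first by case: (QP w).
have [mU iU] := average_path_law H L T HH HL T0 _ S P X XP U B mB.
have QE : (fun w => Q w B) = (fun w => U (location_path L T (X w) @^-1` B)).
  by apply/funext => w; case: (QP w).
by rewrite QE FE.
Qed.

Lemma law_in_P_T : I_LT H L T `<=` P_T T.
Proof.
move=> F /law_disintegration[d [S [P [Q [QE QB]]]]].
have null B : measurable B -> (forall w, Q w B = 0%E) -> F B = 0%E.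
  by move=> mB Q0; rewrite -(proj2 (QB B mB)) integral0_eq.
split.
- apply: null; first by apply: measurableC; exact: measurable_KT.
  by move=> w; case: (QE w) => -[].
- move=> A mA AT A0; apply: null; first exact: measurable_image_EFin.
  by move=> w; case: (QE w) => -[_ h] _; exact: h.
Qed.

(** Each integral is within [e] of its sum over the [N] cells, and the two sums differ by at most
    [M * e'] per cell. *)
Lemma integral_difference_bound (F G : probability (\bar R) R) (phi : \bar R -> R)
    (M e e' : R) N (kappa : \bar R -> nat) (b : nat -> \bar R) :
  F (KT T) = 1%E -> G (KT T) = 1%E -> measurable_fun (KT T) phi ->
  (forall x, KT T x -> `|phi x| <= M) ->
  (forall x, KT T x -> (kappa x < N)%N) ->
  (forall n, measurable (KT T `&` kappa @^-1` [set n])) ->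
  (forall x, KT T x -> `|phi x - phi (b (kappa x))| <= e) ->
  (forall n, KT T (b n)) ->
  (forall n, (n < N)%N -> `|fine (F (KT T `&` kappa @^-1` [set n])) -
     fine (G (KT T `&` kappa @^-1` [set n]))| <= e') ->
  (`|\int[F]_(x in KT T) (phi x)%:E - \int[G]_(x in KT T) (phi x)%:E| <=
    (e + e + N%:R * (M * e'))%:E)%E.
Proof.
move=> F1 G1 mphi bphi kN mk phib bK FG.
have [I -> IF] := integral_value_partition _ (\bar R) (KT T) (measurable_KT T) N kappa kN mk
  F phi M e b F1 mphi bphi phib.
have [J -> JG] := integral_value_partition _ (\bar R) (KT T) (measurable_KT T) N kappa kN mk
  G phi M e b G1 mphi bphi phib.
rewrite -EFinB abse_EFin lee_fin.
set SF := \sum_(n < N) _ in IF; set SG := \sum_(n < N) _ in JG.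
have SFG : `|SF - SG| <= N%:R * (M * e').
  rewrite /SF /SG -sumrB; apply: le_trans (ler_norm_sum _ _ _) _.
  rewrite mulr_natl -[N in leRHS]card_ord -sumr_const; apply: ler_sum => i _.
  rewrite -mulrBr normrM; apply: ler_pM => //; first exact: bphi.
  exact: FG.
have -> : I - J = (I - SF) + (SF - SG) + (SG - J) by lra.
rewrite distrC in JG.
by apply: le_trans (ler_normD _ _) _; have := ler_normD (I - SF) (SF - SG); lra.
Qed.

(** Two discretisations. Cells of [KT T] on which the test functions are nearly constant reduce the
    task to matching cell masses; cells of [Omega] on which these masses under [Q w] are nearly
    constant yield the mixture, one representative path per cell weighted by its probability. *)
Lemma law_in_C_hull : I_LT H L T `<=` C_hull T (E_T T).
Proof.
move=> F IF; have [FK _] := law_in_P_T _ IF; split=> // k phi eps tphi eps0.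
have [d [S [P [Q [QE QB]]]]] := law_disintegration _ IF.
have mphi j := measurable_test_fun T (phi j) (tphi j).
have [M [M0 bphi]] : exists M, 0 <= M /\ forall j x, KT T x -> `|phi j x| <= M.
  have [Ms MsP] := choice (fun j => bounded_test_fun T (phi j) (ltW T0) (tphi j)).
  exists (\sum_j `|Ms j|); split; first exact: sumr_ge0.
  move=> j x Kx; apply: le_trans (MsP j x Kx) _.
  by rewrite (bigD1 j)//=; apply: le_trans (ler_norm _) _; rewrite lerDl sumr_ge0.
have e0 : 0 < eps / 4 by rewrite divr_gt0.
have [N [kappa [kN mk kP]]] := value_partition _ _ (KT T) (measurable_KT T)
  k phi M _ mphi bphi e0.
have [b [bK bk]] := value_partition_points _ _ (KT T) kappa
  (ex_intro _ +oo%E (or_intror erefl)).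
pose B n := KT T `&` kappa @^-1` [set n].
(* Makes [N * M * e'] at most [eps / 4], for a total error of at most three quarters of [eps]; the
   [+ 1] keeps the denominator positive. *)
pose e' := eps / 4 / (N%:R * M + 1).
have NM0 : 0 <= N%:R * M by rewrite mulr_ge0.
have e'0 : 0 < e' by rewrite divr_gt0// ltr_wpDl.
pose Phi (n : 'I_N) w := fine (Q w (B n)).
have finQ w A : measurable A -> Q w A \is a fin_num by exact: fin_num_measure.
have mPhi n : measurable_fun setT (Phi n).
  by apply: measurableT_comp (proj1 (QB _ (mk n))); exact: fine_measurable.
have bPhi n w : setT w -> `|Phi n w| <= 1.
  move=> _; rewrite ger0_norm ?fine_ge0//.
  by rewrite -lee_fin fineK ?(finQ _ _ (mk n))//; apply: probability_le1; exact: mk.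
have [N' [kappa' [kN' mk' kP']]] := value_partition _ _ setT measurableT
  N Phi 1 _ mPhi bPhi e'0.
have [a [_ ak]] := value_partition_points _ _ setT kappa' (ex_intro _ point I).
pose W (i : 'I_N') := fine (P (setT `&` kappa' @^-1` [set nat_of_ord i])).
have P1 : P setT = 1%E by exact: probability_setT.
have W0 i : 0 <= W i by rewrite fine_ge0.
have W1 : \sum_i W i = 1.
  exact: (sum_value_partition _ _ _ N' kappa' kN' mk').
have [G GE] := mixture_probability _ _ N' (fun i : 'I_N' => Q (a i)) W W0 W1.
have G0 : G (~` KT T) = 0%E.
  rewrite GE; last by apply: measurableC; exact: measurable_KT.
  by rewrite big1// => i _; case: (QE (a i)) => -[-> _] _; rewrite mule0.
have full (F' : probability (\bar R) R) : F' (~` KT T) = 0%E -> F' (KT T) = 1%E.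
  move=> F'0; rewrite -[KT T]setCK probability_setC; last by apply: measurableC; exact: measurable_KT.
  by rewrite F'0 sube0.
exists G; split; last split=> // j.
  exists N', (fun i => Q (a i)), W; split; first by move=> i; exact: QE.
  by split; [exact: W0|split].
apply: (@le_lt_trans _ _ (eps / 4 + eps / 4 + N%:R * (M * e'))%:E).
  apply: (integral_difference_bound F G (phi j) M (eps / 4) e' N kappa b) => //.
  - exact: full.
  - exact: full.
  - exact: bphi.
  - by move=> x Kx; apply: kP => //; rewrite bk.
  - move=> n nN; have [I IE Ib] := integral_value_partition _ _ _ measurableT N' kappa' kN' mk'
      P (Phi (Ordinal nN)) 1 e' a P1 (mPhi _) (bPhi _)
      (fun w _ => kP' w _ I I (esym (ak w I)) (Ordinal nN)).
    have FB : F (B n) = I%:E.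
      rewrite -(proj2 (QB _ (mk n))) -IE; apply: eq_integral => w _.
      by rewrite fineK//; exact: (finQ _ _ (mk n)).
    have GB : fine (G (B n)) = \sum_(i < N') Phi (Ordinal nN) (a i) * W i.
      rewrite GE//; last exact: mk.
      rewrite (eq_bigr (fun i : 'I_N' => (Phi (Ordinal nN) (a i) * W i)%:E)).
        by rewrite sumEFin.
      by move=> i _; rewrite mulrC EFinM /Phi (fineK (finQ _ _ (mk n))).
    by rewrite -/(B n) FB GB.
rewrite lte_fin.
have : N%:R * (M * e') <= eps / 4.
  rewrite mulrA /e' mulrA ler_pdivrMr ?ltr_wpDl// mulrC ler_pM2l//.
  by rewrite lerDl.
lra.
Qed.

End Laws.

Theorem mainTheorem3 (R : realType) (H : set (R -> R))
  (L : (R -> R) -> R -> R -> \bar R) (T : R) :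
  admissible_H H -> intrinsic_location H L -> 0 < T -> T <= 1 ->
  (I_LT H L T `<=` P_T T /\ convex_laws (I_LT H L T)) /\
  I_LT H L T `<=` C_hull T (E_T T).
Proof.
move=> HH HL T0 T1; split; last exact: law_in_C_hull.
by split; [exact: law_in_P_T|exact: convex_location_laws].
Qed.
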